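(* Let $N\ge1$ and let $X=\{X_t;\ t\in\mathbf{R}^N_+\}$ be a continuous Gaussian process. Let $t_0\in\mathbf{R}^N_+$ be such that almost surely the graph $\{(s',\boldsymbol{\sigma}_{t_0}(s')) : s'<0\}$ meets the region $D$. Then the $2$-microlocal frontier $s'\mapsto\boldsymbol{\sigma}_{t_0}(s')$ of $X$ at $t_0$ is almost surely equal to the function $s'\mapsto\sigma^{\det}_{t_0}(s')$ (the deterministic $2$-microlocal frontier).
   Context: $\mathbf{R}^N_+=[0,\infty)^N$ with norm $\|\cdot\|$; $B(t_0,\rho)$ is the ball of centre $t_0$ and radius $\rho$ in $\mathbf{R}^N_+$; suprema of quotients with $\|t-u\|$ in the denominator are over $t\ne u$; $E[X_t-X_u]^2$ denotes $E[(X_t-X_u)^2]$. The (random) $2$-microlocal frontier of $X$ at $t_0$ is defined for $s'\in(-\infty,0)$ by $$\boldsymbol{\sigma}_{t_0}(s')=\sup\Big\{\sigma:\ \limsup_{\rho\to0}\ \sup_{t,u\in B(t_0,\rho)}\frac{|X_t-X_u|}{\|t-u\|^{\sigma}\rho^{-s'}}<\infty\Big\},$$ and the deterministic $2$-microlocal frontier is $$\sigma^{\det}_{t_0}(s')=\sup\Big\{\sigma:\ \limsup_{\rho\to0}\ \sup_{t,u\in B(t_0,\rho)}\frac{E[X_t-X_u]^2}{\|t-u\|^{2\sigma}\rho^{-2s'}}<\infty\Big\}.$$ $D=\{(s',\sigma): -1<s'<0,\ 0<\sigma<1+s'\}$. *)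

(* Defs.v *)
From HB Require Import structures.
From mathcomp Require Import all_boot all_order all_algebra.
From mathcomp Require Import all_classical all_reals all_analysis.
Set Implicit Arguments.
Unset Strict Implicit.
Unset Printing Implicit Defensive.
Import Order.TTheory GRing.Theory Num.Theory.
Import numFieldNormedType.Exports.
Local Open Scope classical_set_scope.
Local Open Scope ring_scope.

Definition is_norm (R : realType) (N : nat) (nrm : 'rV[R]_N -> R) : Prop :=
  [/\ forall x, nrm x = 0 -> x = 0,
      forall (a : R) x, nrm (a *: x) = `|a| * nrm x
    & forall x y, nrm (x + y) <= nrm x + nrm y].

Definition orthant (R : realType) (N : nat) : set 'rV[R]_N :=
  [set t | forall i, 0 <= t ord0 i].

Arguments orthant : clear implicits.

Definition oball (R : realType) (N : nat) (nrm : 'rV[R]_N -> R)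
    (t0 : 'rV[R]_N) (rho : R) : set 'rV[R]_N :=
  [set t | orthant R N t /\ nrm (t - t0) < rho].

(* Point masses count as Gaussian laws; they are treated apart because
   [normal_prob m 0] is not the Dirac measure at [m]. *)
Definition gaussian_rv d (T : measurableType d) (R : realType)
    (P : probability T R) (Y : T -> R) : Prop :=
  measurable_fun [set: T] Y /\
  exists m s : R, 0 <= s /\
    forall A : set R, measurable A ->
      P (Y @^-1` A) = if s == 0 then \d_m A else normal_prob m s A.

(* Processes are indexed by all of R^N, but every condition and definition
   below only involves their values on the orthant. *)
Definition gaussian_process d (T : measurableType d) (R : realType)
    (P : probability T R) (N : nat) (X : 'rV[R]_N -> T -> R) : Prop :=
  forall (k : nat) (t : 'I_k -> 'rV[R]_N) (a : 'I_k -> R),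
    (forall i, orthant R N (t i)) ->
    gaussian_rv P (fun w => \sum_(i < k) a i * X (t i) w).

Definition continuous_process d (T : measurableType d) (R : realType)
    (P : probability T R) (N : nat) (X : 'rV[R]_N -> T -> R) : Prop :=
  {ae P, forall w, {within orthant R N, continuous (fun t => X t w)}}.

(* The frontier of a single path [f]; the supremum is taken in the extended
   reals, so it is +oo for instance when [f] is constant near [t0]. *)
Definition frontier (R : realType) (N : nat) (nrm : 'rV[R]_N -> R)
    (f : 'rV[R]_N -> R) (t0 : 'rV[R]_N) (s' : R) : \bar R :=
  ereal_sup [set sigma%:E | sigma in [set sigma : R |
    (limf_esup (fun rho : R =>
       ereal_sup [set z : \bar R | exists t u : 'rV[R]_N,
         [/\ oball nrm t0 rho t, oball nrm t0 rho u, t != u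
           & z = (`|f t - f u| /
                  (nrm (t - u) `^ sigma * rho `^ (- s')))%:E]])
       (0 : R)^'+ < +oo)%E]].

Definition det_frontier d (T : measurableType d) (R : realType)
    (P : probability T R) (N : nat) (nrm : 'rV[R]_N -> R)
    (X : 'rV[R]_N -> T -> R) (t0 : 'rV[R]_N) (s' : R) : \bar R :=
  ereal_sup [set sigma%:E | sigma in [set sigma : R |
    (limf_esup (fun rho : R =>
       ereal_sup [set z : \bar R | exists t u : 'rV[R]_N,
         [/\ oball nrm t0 rho t, oball nrm t0 rho u, t != u
           & z = ('E_P[(fun w => (X t w - X u w) ^+ 2)%R] /
                  (nrm (t - u) `^ (2 * sigma) *
                   rho `^ (- (2 * s')))%R%:E)%E]])
       (0 : R)^'+ < +oo)%E]].

Definition regionD (R : realType) : set (R * R) :=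
  [set p | [/\ -1 < p.1, p.1 < 0, 0 < p.2 & p.2 < 1 + p.1]].

Definition graph_meets (R : realType) (g : R -> \bar R) (D : set (R * R)) :
    Prop :=
  exists s' sigma : R, [/\ s' < 0, g s' = sigma%:E & D (s', sigma)].

(* Main.v *)
Require Import Defs.
From mathcomp Require Import all_boot all_order all_algebra.
From mathcomp Require Import all_classical all_reals all_analysis.
From mathcomp Require Import measurable_realfun.
From mathcomp Require Import ring lra zify.
Import Order.TTheory GRing.Theory Num.Theory.
Import numFieldNormedType.Exports.
Local Open Scope classical_set_scope.
Local Open Scope ring_scope.
Set Implicit Arguments.
Unset Strict Implicit.
Unset Printing Implicit Defensive.

(* Both frontiers are suprema of exponents [sigma] that are admissible for an
   increment functional: [|X_t - X_u|] for a path, and the L^2 norm of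
   [X_t - X_u] for the deterministic frontier.
   If a path is admissible at [(s', sigma)] with positive probability, then one
   bound on the normalised increments holds with probability at least [c] for
   all [t, u] simultaneously; an increment being Gaussian, this bounds its
   second moment, so [(s', sigma)] is admissible in L^2.  Running over rational
   [(s', sigma)] gives "frontier <= deterministic frontier" almost surely.
   Conversely, if [(s', sigma)] is L^2-admissible and [0 < tau < sigma],
   Kolmogorov's chaining argument, run simultaneously on dyadic grids of cubes
   of radius [2^-j] around [t0] with high moments of the increments, makes
   [(s', tau)] almost surely admissible for the paths.
   Chaining says nothing when [sigma <= 0].  There the condition only concerns
   the oscillation around [t0], so L^2-admissibility at [(s', sigma)] moves to
   [(s' - sigma, 0)].  As the path frontier meets D, some [(s0, sigma0)] with
   [s0 < 0 < sigma0] is L^2-admissible; interpolating slightly towards it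
   reaches positive exponents, where chaining applies, and shifting back loses
   arbitrarily little. *)

(** * Norms on row vectors *)

Lemma norm_rv_le (R : realType) (N : nat) (x : 'rV[R]_N) (c : R) :
  0 <= c -> (forall i, `|x ord0 i| <= c) -> `|x| <= c.
Proof.
move=> c0 h; rewrite {1}/Num.norm/= mx_normrE.
by apply/bigmax_leP; split => // -[i j] _ /=; rewrite ord1; exact: h.
Qed.

Lemma coord_le_norm (R : realType) (N : nat) (x : 'rV[R]_N) i :
  `|x ord0 i| <= `|x|.
Proof.
rewrite {2}/Num.norm/= mx_normrE.
exact: (le_bigmax _ (fun i : 'I_1 * 'I_N => `|x i.1 i.2|) (ord0, i)).
Qed.

Section norm_equivalence.
Context {R : realType} {N : nat} {nrm : 'rV[R]_N -> R}.
Hypothesis hnrm : is_norm nrm.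

Lemma nrm_triangle x y : nrm (x + y) <= nrm x + nrm y.
Proof. by case: hnrm. Qed.

Lemma nrmZ (a : R) x : nrm (a *: x) = `|a| * nrm x.
Proof. by case: hnrm. Qed.

Lemma nrm0 : nrm 0 = 0.
Proof. by rewrite -(scale0r 0) nrmZ normr0 mul0r. Qed.

Lemma nrmN x : nrm (- x) = nrm x.
Proof. by rewrite -scaleN1r nrmZ normrN1 mul1r. Qed.

Lemma nrm_ge0 x : 0 <= nrm x.
Proof.
have := nrm_triangle x (- x).
by rewrite subrr nrm0 nrmN -mulr2n pmulrn_lge0.
Qed.

Lemma nrm_gt0 x : x != 0 -> 0 < nrm x.
Proof.
move=> x0; rewrite lt_neqAle nrm_ge0 andbT; apply: contra x0 => /eqP h.
by apply/eqP; case: hnrm => h0 _ _; apply: h0.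
Qed.

Lemma nrm_distC x y : nrm (x - y) = nrm (y - x).
Proof. by rewrite -nrmN opprB. Qed.

Lemma nrm_sum (I : finType) (F : I -> 'rV[R]_N) :
  nrm (\sum_i F i) <= \sum_i nrm (F i).
Proof.
elim/big_ind2: _ => [|x x' y y' hx hy|//]; first by rewrite nrm0.
by rewrite (le_trans (nrm_triangle _ _))// lerD.
Qed.

Lemma nrm_le_norm : exists2 c : R, 0 < c & forall x, nrm x <= c * `|x|.
Proof.
(* Expanding in the canonical basis gives the sum of the norms of the basis vectors; the extra 1
   makes the constant positive even for [N = 0]. *)
exists (1 + \sum_i nrm (delta_mx ord0 i)).
  by rewrite ltr_pwDl// sumr_ge0// => i _; exact: nrm_ge0.
move=> x; rewrite {1}(row_sum_delta x).
apply: (le_trans (nrm_sum _)).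
rewrite mulrDl mul1r mulr_suml -[leLHS]add0r lerD// ler_sum// => i _.
by rewrite nrmZ mulrC ler_wpM2l ?nrm_ge0// coord_le_norm.
Qed.

Lemma nrm_continuous : continuous nrm.
Proof.
have [c c0 hc] := nrm_le_norm.
move=> x; apply/(@cvgrPdist_le _ R^o _ (nbhs x)) => e e0; near=> y.
have xy : ball x (e / c) y.
  by near: y; apply: nbhsx_ballx; rewrite divr_gt0.
move: xy; rewrite -ball_normE /= => xy.
 apply: (@le_trans _ _ (nrm (x - y))).
  rewrite ler_norml.
  have := nrm_triangle (x - y) y; rewrite subrK => h1.
  have := nrm_triangle (y - x) x; rewrite subrK nrm_distC => h2.
  by apply/andP; split; lra.
apply: (le_trans (hc _)).
by rewrite mulrC -ler_pdivlMr// ltW.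
Unshelve. all: by end_near. Qed.

(** By compactness [nrm] attains a positive minimum on the unit sphere of the sup norm, and
    homogeneity does the rest. The sphere is nonempty because [0 < N]. *)
Lemma norm_le_nrm : (0 < N)%N -> exists2 c : R, 0 < c & forall x, `|x| <= c *
  nrm x.
Proof.
move=> N0.
pose S := [set x : 'rV[R]_N | `|x| = 1].
have S0 : S !=set0.
  pose y : 'rV[R]_N := const_mx 1.
  have y0 : y != 0.
    apply/negP => /eqP/matrixP/(_ ord0 (Ordinal N0)); rewrite !mxE => /eqP.
    by rewrite oner_eq0.
  exists (`|y|^-1 *: y); rewrite /S/= normrZ normfV normr_id mulVf//.
  by rewrite normr_eq0.
have cS : compact S.
  apply: bounded_closed_compact.
    exists 1; split => // M M1 x /= ->; exact: ltW.
  have -> : S = (fun x : 'rV[R]_N => `|x|) @^-1` [set 1] by [].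
  apply: preimage_closed; last exact: closed_eq.
  by move=> x _; exact: norm_continuous.
have [x0 + min0] := compact_EVT_min S0 cS
  (continuous_subspaceT nrm_continuous).
rewrite inE /S /= => x01.
have nx0 : 0 < nrm x0.
  by apply: nrm_gt0; rewrite -normr_eq0 x01 oner_eq0.
exists (nrm x0)^-1; first by rewrite invr_gt0.
move=> x; have [->|xn0] := eqVneq x 0; first by rewrite normr0 nrm0 mulr0.
have xp : 0 < `|x| by rewrite normr_gt0.
have := min0 (`|x|^-1 *: x); rewrite nrmZ normfV normr_id => h.
rewrite mulrC ler_pdivlMr// -ler_pdivlMl//; apply: h.
by rewrite inE /S/= normrZ normfV normr_id mulVf// gt_eqF.
Qed.
End norm_equivalence.

(** * Admissible exponents *)

Lemma powR_le_pos (R : realType) (a x y : R) :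
  0 <= a -> 0 <= x -> x <= y -> x `^ a <= y `^ a.
Proof.
move=> a0 x0 xy; apply: ge0_ler_powR => //; rewrite nnegrE//.
exact: le_trans xy.
Qed.

(** A right neighbourhood of 0 contains an interval from 0 to some [delta], and a supremum below
    [+oo] has a nonnegative real bound. Both limsups in the frontiers thus become explicit
    constants. *)
Lemma limf_esup_sup_ltyP (R : realType) (B : R -> set (\bar R)) :
  (limf_esup (fun rho => ereal_sup (B rho)) 0^'+ < +oo)%E <->
  exists delta C : R, [/\ 0 < delta, 0 <= C &
    forall rho, 0 < rho -> rho < delta -> forall z, B rho z -> (z <= C%:E)%E].
Proof.
split.
  rewrite limf_esupE => /ereal_inf_lt [_ [V V0 <-]] supV.
  have [C C0 hC] : exists2 C : R, 0 <= C &
      (ereal_sup [set ereal_sup (B rho) | rho in V] <= C%:E)%E.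
    move: supV; case: (ereal_sup _) => [r _|//|_].
      by exists `|r|; rewrite // lee_fin ler_norm.
    by exists 0; rewrite // leNye.
  move: V0 => [delta /= d0 hV]; exists delta, C; split => // rho r0 rd z Bz.
  apply: (le_trans _ hC); apply: (@le_trans _ _ (ereal_sup (B rho))).
    exact: ereal_sup_ubound.
  apply: ereal_sup_ubound; exists rho => //; apply: hV => //=.
  by rewrite sub0r normrN gtr0_norm.
move=> [delta [C [d0 C0 h]]]; rewrite limf_esupE.
apply: (@le_lt_trans _ _ C%:E); last exact: ltry.
apply: (@le_trans _ _ (ereal_sup [set ereal_sup (B rho) |
    rho in [set rho | 0 < rho < delta]])).
  apply: ereal_inf_lbound; exists [set rho | 0 < rho < delta] => //.
  near=> rho; apply/andP; split; near: rho.
    exact: nbhs_right_gt.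
  exact: nbhs_right_lt.
apply: ge_ereal_sup => _ [rho /= /andP[r0 rd] <-].
by apply: ge_ereal_sup => z; exact: h.
Unshelve. all: by end_near. Qed.

Section two_microlocal.
Context {R : realType} {N : nat} {nrm : 'rV[R]_N -> R}.
Hypothesis hnrm : is_norm nrm.
Variable t0 : 'rV[R]_N.
Local Notation B := (oball nrm t0).
Implicit Types g : 'rV[R]_N -> 'rV[R]_N -> R.

(** Radius and constant are kept as parameters so that admissibility can later be written as a
    countable union over integer values of both. *)
Definition microlocal_bound g (s' sigma delta C : R) : Prop :=
  forall rho t u, 0 < rho -> rho < delta -> B rho t -> B rho u -> t != u ->
    g t u <= C * (nrm (t - u) `^ sigma * rho `^ (- s')).

Definition admissible g (s' sigma : R) : Prop :=
  exists delta C : R, [/\ 0 < delta, 0 <= C & microlocal_bound g s' sigma delta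
    C].

Lemma oball_dist_gt0 t u : t != u -> 0 < nrm (t - u).
Proof. by move=> tu; apply: (nrm_gt0 hnrm); rewrite subr_eq0. Qed.

Lemma oball_dist_lt rho t u : B rho t -> B rho u -> nrm (t - u) <= 2 * rho.
Proof.
move=> [_ tr] [_ ur].
have := nrm_triangle hnrm (t - t0) (t0 - u).
rewrite addrA subrK (nrm_distC hnrm t0 u) => h.
by rewrite (le_trans h)// mulr2n mulrDl mul1r lerD// ltW.
Qed.

Lemma admissible_exponent_le g s' s'' sigma : s' <= s'' ->
  admissible g s' sigma -> admissible g s'' sigma.
Proof.
move=> ss [delta [C [d0 C0 h]]].
exists (Num.min delta 1), C; split => //; first by rewrite lt_min d0 ltr01.
move=> rho t u r0; rewrite lt_min => /andP[rd r1] Bt Bu tu.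
apply: (le_trans (h rho t u r0 rd Bt Bu tu)).
rewrite ler_wpM2l// ler_wpM2l ?powR_ge0//.
by apply: ger_powR; [rewrite r0 ltW | rewrite lerN2].
Qed.

Lemma admissible_shift g s' sigma e : 0 <= e ->
  admissible g s' sigma -> admissible g (s' - e) (sigma - e).
Proof.
move=> e0 [delta [C [d0 C0 h]]].
exists delta, (C * 2 `^ e); split => //; first by rewrite mulr_ge0// powR_ge0.
move=> rho t u r0 rd Bt Bu tu.
apply: (le_trans (h rho t u r0 rd Bt Bu tu)).
rewrite -mulrA ler_wpM2l//.
have x0 := oball_dist_gt0 tu; have x2 := oball_dist_lt Bt Bu.
rewrite -{1}(subrK e sigma) [nrm _ `^ (_ + e)]powRD ?(gt_eqF x0)/= ?implybT//.
rewrite opprB [rho `^ (e - s')]powRD; last by rewrite (gt_eqF r0) implybT.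
rewrite [X in _ <= X](_ : _ = (nrm (t - u)) `^ (sigma - e) *
  (2 `^ e * rho `^ e) * rho `^ (- s')); last first.
  by rewrite mulrCA !mulrA.
rewrite -powRM ?(ltW r0)//.
rewrite ler_wpM2r ?powR_ge0// ler_wpM2l ?powR_ge0//.
by apply: powR_le_pos => //; exact: ltW.
Qed.

(** Raising [s'] is free and lowering it costs as much in [sigma]; in either direction the loss is
    at most the distance moved. *)
Lemma admissible_dist g s' s'' sigma :
  admissible g s' sigma -> admissible g s'' (sigma - `|s' - s''|).
Proof.
move=> h; have [ss|ss] := leP s'' s'.
  rewrite ger0_norm ?subr_ge0//.
  have := @admissible_shift g s' sigma (s' - s'').
  by rewrite subr_ge0 subKr; exact.
apply: (@admissible_exponent_le _ (s' - `|s' - s''|)).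
  by rewrite (le_trans _ (ltW ss))// gerBl.
exact: admissible_shift.
Qed.

Lemma admissible_le g s' sigma tau : tau <= sigma ->
  admissible g s' sigma -> admissible g s' tau.
Proof.
move=> ts /(@admissible_shift _ _ _ (sigma - tau)); rewrite subr_ge0 => /(_ ts).
rewrite subKr; apply: admissible_exponent_le.
by rewrite gerBl subr_ge0.
Qed.

(** Take the weighted geometric mean of the two bounds, writing [g] as the product of its powers
    [1 - th] and [th]. *)
Lemma admissible_interp g s1 s2 sigma1 sigma2 th : (forall t u, 0 <= g t u) ->
  0 <= th <= 1 -> admissible g s1 sigma1 -> admissible g s2 sigma2 ->
  admissible g ((1 - th) * s1 + th * s2) ((1 - th) * sigma1 + th * sigma2).
Proof.
move=> g0 /andP[th0 th1] [d1 [C1 [d10 C10 h1]]] [d2 [C2 [d20 C20 h2]]].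
exists (Num.min d1 d2), (C1 `^ (1 - th) * C2 `^ th).
split; [by rewrite lt_min d10 | by rewrite mulr_ge0 ?powR_ge0 |].
move=> rho t u r0; rewrite lt_min => /andP[rd1 rd2] Bt Bu tu.
have x0 := oball_dist_gt0 tu.
have th1' : 0 <= 1 - th by rewrite subr_ge0.
have -> : g t u = g t u `^ (1 - th) * g t u `^ th.
  by rewrite -powRD subrK ?powRr1// oner_eq0.
have k1 := powR_le_pos th1' (g0 t u) (h1 rho t u r0 rd1 Bt Bu tu).
have k2 := powR_le_pos th0 (g0 t u) (h2 rho t u r0 rd2 Bt Bu tu).
apply: (le_trans (ler_pM (powR_ge0 _ _) (powR_ge0 _ _) k1 k2)).
rewrite !powRM ?mulr_ge0 ?powR_ge0// -!powRrM.
rewrite (_ : - (_ + _) = - s1 * (1 - th) + - s2 * th); last by ring.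
rewrite (mulrC (1 - th) sigma1) (mulrC th sigma2).
rewrite [nrm _ `^ (_ + _)]powRD ?(gt_eqF x0) ?implybT//.
rewrite [rho `^ (_ + _)]powRD ?(gt_eqF r0) ?implybT//.
by rewrite le_eqVlt; apply/orP; left; apply/eqP; ring.
Qed.

(* For [sigma <= 0] the condition reduces to the oscillation around [t0], which
   is the condition at exponent [0]. *)
Lemma admissible_nonpos g s' sigma K : orthant R N t0 -> s' < sigma -> 0 <= K ->
  g t0 t0 = 0 ->
  (forall t u, orthant R N t -> orthant R N u -> g t u <= K * (g t t0 + g u
    t0)) ->
  admissible g s' sigma -> admissible g (s' - sigma) 0.
Proof.
move=> ot0 ss K0 g0 gK [delta [C [d0 C0 h]]].
exists (delta / 2), (K * (2 * (C * 2 `^ (- s')))).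
split; rewrite ?divr_gt0// ?mulr_ge0 ?powR_ge0//.
(* Both [t] and [t0] lie in the ball of radius [2 * nrm (t - t0)]. With that radius the two weights
   merge into one power of the distance, of positive exponent [sigma - s']. *)
have pt rho t : 0 < rho -> rho < delta / 2 -> B rho t ->
    g t t0 <= C * 2 `^ (- s') * rho `^ (sigma - s').
  move=> r0 rd [ot tr]; have [->|tt0] := eqVneq t t0.
    by rewrite g0 !mulr_ge0 ?powR_ge0.
  have x0 := oball_dist_gt0 tt0.
  have k : g t t0 <= C * (nrm (t - t0) `^ sigma * (2 * nrm (t - t0)) `^ (- s')).
    apply: h => //.
    - by rewrite mulr_gt0.
    - by rewrite mulrC -ltr_pdivlMr// (lt_trans tr).
    - by split => //; rewrite ltr_pMl// ltr1n.
    - by split => //; rewrite subrr (nrm0 hnrm) mulr_gt0.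
  apply: (le_trans k); rewrite powRM ?(ltW x0)// [X in C * X]mulrCA.
  rewrite -mulrA ler_wpM2l// ler_wpM2l ?powR_ge0//.
  rewrite -powRD ?(gt_eqF x0) ?implybT//.
  by apply: powR_le_pos; rewrite ?subr_ge0 ?ltW.
move=> rho t u r0 rd Bt Bu tu; rewrite powRr0 mul1r opprB.
apply: (le_trans (gK t u Bt.1 Bu.1)).
rewrite -!mulrA ler_wpM2l// mulr2n mulrDl mul1r !mulrA.
by apply: lerD; exact: pt.
Qed.

End two_microlocal.

(** * Frontiers as suprema of admissible exponents *)

Section frontiers.
Context {R : realType} {N : nat} {nrm : 'rV[R]_N -> R}.
Hypothesis hnrm : is_norm nrm.
Variable t0 : 'rV[R]_N.
Local Notation B := (oball nrm t0).
Local Notation admissible := (@admissible R N nrm t0).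

Definition adm_sup (g : 'rV[R]_N -> 'rV[R]_N -> R) (s' : R) : \bar R :=
  ereal_sup [set sigma%:E | sigma in [set sigma | admissible g s' sigma]].

Lemma frontierE (f : 'rV[R]_N -> R) s' :
  frontier nrm f t0 s' = adm_sup (fun t u => `|f t - f u|) s'.
Proof.
congr (ereal_sup [set _ | _ in _]); apply/seteqP; split => sigma /=.
  move=> /limf_esup_sup_ltyP[delta [C [d0 C0 h]]].
  exists delta, C; split => // rho t u r0 rd Bt Bu tu.
  have D0 : 0 < nrm (t - u) `^ sigma * rho `^ (- s').
    by rewrite mulr_gt0// powR_gt0// (oball_dist_gt0 hnrm).
  rewrite -ler_pdivrMr// -lee_fin; apply: (h rho) => //.
  by exists t, u; split.
move=> [delta [C [d0 C0 h]]]; apply/limf_esup_sup_ltyP.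
exists delta, C; split => // rho r0 rd _ [t [u [Bt Bu tu ->]]].
rewrite lee_fin ler_pdivrMr; first exact: h.
by rewrite mulr_gt0// powR_gt0// (oball_dist_gt0 hnrm).
Qed.

(** The weight with doubled exponents is the square of the path weight, so a bound [C ^+ 2] on the
    quotient of second moments is a bound [C] on the quotient of [g]. *)
Lemma det_frontierE d (T : measurableType d) (P : probability T R)
    (X : 'rV[R]_N -> T -> R) (g : 'rV[R]_N -> 'rV[R]_N -> R) s' :
  (forall t u, 0 <= g t u) ->
  (forall t u, orthant R N t -> orthant R N u ->
    ('E_P[(fun w => (X t w - X u w) ^+ 2)%R] = (g t u ^+ 2)%:E)%E) ->
  det_frontier P nrm X t0 s' = adm_sup g s'.
Proof.
move=> g0 gE.
have key rho sigma t u C : 0 < rho -> B rho t -> B rho u -> t != u -> 0 <= C ->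
    ('E_P[(fun w => (X t w - X u w) ^+ 2)%R] /
      (nrm (t - u) `^ (2 * sigma) * rho `^ (- (2 * s')))%R%:E <= (C ^+ 2)%:E)%E
    = (g t u <= C * (nrm (t - u) `^ sigma * rho `^ (- s'))).
  move=> r0 Bt Bu tu C0.
  have D0 : 0 < nrm (t - u) `^ sigma * rho `^ (- s').
    by rewrite mulr_gt0// powR_gt0// (oball_dist_gt0 hnrm).
  have -> : nrm (t - u) `^ (2 * sigma) * rho `^ (- (2 * s')) =
      (nrm (t - u) `^ sigma * rho `^ (- s')) ^+ 2.
    rewrite -mulrN (mulrC 2 sigma) (mulrC 2 (- s')) !powRrM exprMn.
    by rewrite !powR_mulrn ?powR_ge0.
  rewrite gE ?(Bt.1) ?(Bu.1) //; [|exact: Bt.1|exact: Bu.1].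
  rewrite inver gt_eqF ?exprn_gt0// -EFinM lee_fin -exprVn -exprMn.
  rewrite -[in RHS]ler_pdivrMr// ler_sqr// nnegrE divr_ge0//.
  exact: ltW.
congr (ereal_sup [set _ | _ in _]); apply/seteqP; split => sigma /=.
  move=> /limf_esup_sup_ltyP[delta [C [d0 C0 h]]].
  exists delta, (Num.sqrt C); split; [by []|exact: sqrtr_ge0|].
  move=> rho t u r0 rd Bt Bu tu.
  rewrite -key ?sqrtr_ge0// sqr_sqrtr//; apply: (h rho) => //.
  by exists t, u; split.
move=> [delta [C [d0 C0 h]]]; apply/limf_esup_sup_ltyP.
exists delta, (C ^+ 2); split; rewrite ?sqr_ge0// => rho r0 rd _ [t [u [Bt Bu
  tu ->]]].
rewrite key//; exact: (h rho).
Qed.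

Lemma adm_sup_le (f g : 'rV[R]_N -> 'rV[R]_N -> R) s' :
  (forall sigma e, admissible f s' sigma -> 0 < e -> admissible g s' (sigma -
    e)) ->
  (adm_sup f s' <= adm_sup g s')%E.
Proof.
move=> h; apply: ge_ereal_sup => _ [sigma /= hs <-].
apply/lee_addgt0Pr => e e0; rewrite -leeBlDr//.
by rewrite -EFinB; apply: ereal_sup_ubound; exists (sigma - e) => //=; exact: h.
Qed.

Section comparison.
Variables f g : 'rV[R]_N -> 'rV[R]_N -> R.

(** Rational exponents suffice, which leaves only countably many null sets to discard. Taking [q]
    just above [s'] and [r] just below [sigma] costs less than [e / 2] each. *)
Lemma admissible_transfer :
  (forall q r : rat, admissible f (ratr q) (ratr r) -> admissible g (ratr q)
    (ratr r)) ->
  forall s' sigma e, admissible f s' sigma -> 0 < e -> admissible g s' (sigma -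
    e).
Proof.
move=> h s' sigma e fs e0.
have [q /[!in_itv]/= /andP[q1 q2]] : exists q : rat, ratr q \in `]s', s' + e /
  2[.
  by apply: rat_in_itvoo; lra.
have [r /[!in_itv]/= /andP[r1 r2]] : exists r : rat, ratr r \in `]sigma - e /
  2, sigma[.
  by apply: rat_in_itvoo; lra.
have : admissible f (ratr q) (ratr r).
  apply: (@admissible_exponent_le _ _ _ _ _ s'); first exact: ltW.
  by apply: (admissible_le hnrm) fs; exact: ltW.
move=> /h/(admissible_dist hnrm s'); apply: (admissible_le hnrm).
by rewrite ger0_norm; lra.
Qed.

(** Same approximation, with a third rational [p < r] for the exponent lost in chaining; [q] must
    stay negative and [p] positive for chaining to apply. *)
Lemma admissible_transfer_pos :
  (forall q r p : rat, ratr q < 0 :> R -> 0 < ratr p :> R -> ratr p < ratr r :>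
    R ->
    admissible g (ratr q) (ratr r) -> admissible f (ratr q) (ratr p)) ->
  forall s' sigma e, s' < 0 -> 0 < sigma ->
    admissible g s' sigma -> 0 < e -> admissible f s' (sigma - e).
Proof.
move=> h s' sigma e s0 sg0 gs e0.
have [q] : exists q : rat, ratr q \in `]s', (Num.min (s' + e / 2) 0)[.
  by apply: rat_in_itvoo; rewrite lt_min s0 andbT; lra.
rewrite in_itv/= lt_min => /and3P[q1 q2 q3].
have [p] : exists p : rat, ratr p \in `](Num.max (sigma - e / 2) 0), sigma[.
  by apply: rat_in_itvoo; rewrite gt_max sg0 andbT; lra.
rewrite in_itv/= gt_max => /andP[/andP[p1 p2] p3].
have [r /[!in_itv]/= /andP[r1 r2]] := rat_in_itvoo p3.
have : admissible g (ratr q) (ratr r).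
  apply: (@admissible_exponent_le _ _ _ _ _ s'); first exact: ltW.
  by apply: (admissible_le hnrm) gs; exact: ltW.
move=> /h-/(_ _ q3 p2 r1)/(admissible_dist hnrm s'); apply: (admissible_le
  hnrm).
by rewrite ger0_norm; lra.
Qed.

Lemma admissible_transfer_neg K : orthant R N t0 -> 0 <= K ->
  (forall t u, 0 <= g t u) -> g t0 t0 = 0 ->
  (forall t u, orthant R N t -> orthant R N u -> g t u <= K * (g t t0 + g u
    t0)) ->
  (forall s' sigma e, s' < 0 -> 0 < sigma ->
    admissible g s' sigma -> 0 < e -> admissible f s' (sigma - e)) ->
  forall s0 sigma0, s0 < 0 -> 0 < sigma0 -> admissible g s0 sigma0 ->
  forall s' sigma e, s' < 0 ->
    admissible g s' sigma -> 0 < e -> admissible f s' (sigma - e).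
Proof.
move=> ot0 K0 g0 gt0 gK h s0 sigma0 s00 sg00 g00 s' sigma e s'0 gs e0.
have [/h|sg0] := ltP 0 sigma; first exact.
have [ss|ss] := leP sigma s'.
  (* Here the positive point alone suffices: moving from [s0 < 0] down to [s'] costs less than
     [- s'], which leaves an exponent above [s' >= sigma]. *)
  have e1 : 0 < sigma0 / 2 by rewrite divr_gt0.
  have := h _ _ _ s00 sg00 g00 e1.
  have [s0s'|s's0] := leP s0 s'.
    move=> /(admissible_exponent_le s0s'); apply: (admissible_le hnrm); lra.
  move=> /(admissible_dist hnrm s'); apply: (admissible_le hnrm).
  by rewrite ger0_norm; lra.
have g1 := admissible_nonpos hnrm ot0 ss K0 gt0 gK gs.
pose s1 := s' - sigma.
have s10 : s1 < 0 by rewrite subr_lt0.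
(* [th] small makes the interpolated point close to [(s1, 0)] *)
pose th := Num.min 1 (e / 2 / (1 + `|s0 - s1|)).
have D0 : 0 < 1 + `|s0 - s1| by rewrite ltr_pwDl.
have th0 : 0 < th by rewrite lt_min ltr01 !divr_gt0.
have th1 : th <= 1 by rewrite ge_min lexx.
have the : th * `|s0 - s1| <= e / 2.
  have : th <= e / 2 / (1 + `|s0 - s1|) by rewrite ge_min lexx orbT.
  rewrite ler_pdivlMr// => /(le_trans _); apply.
  by rewrite ler_pM2l// lerDr.
have := admissible_interp hnrm g0 _ g1 g00.
move=> /(_ th); rewrite (ltW th0) th1 => /(_ isT).
rewrite mulr0 add0r -/s1; set s2 := (1 - th) * s1 + th * s0.
have s20 : s2 < 0.
  rewrite /s2; have [->|thn1] := eqVneq th 1; first by rewrite subrr mul0r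
    add0r mul1r.
  have : 0 < 1 - th by rewrite subr_gt0 lt_neqAle thn1.
  by move=> a; nra.
(* Giving up the whole positive exponent [th * sigma0] puts the path at [(s2, 0)]. As
   [s2 <= s1 + e / 2], returning to [s'] costs at most [- sigma + e / 2]. *)
move=> /(h _ _ (th * sigma0)) => /(_ s20).
rewrite subrr mulr_gt0// => /(_ isT isT).
have [s2s'|s's2] := leP s2 s'.
  by move=> /(admissible_exponent_le s2s'); apply: (admissible_le hnrm); lra.
move=> /(admissible_dist hnrm s'); apply: (admissible_le hnrm).
rewrite sub0r gtr0_norm ?subr_gt0//.
have -> : s2 = s1 + th * (s0 - s1) by rewrite /s2; ring.
have : th * (s0 - s1) <= th * `|s0 - s1| by rewrite ler_pM2l// ler_norm.
by rewrite /s1 in the *; lra.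
Qed.

End comparison.
End frontiers.

(** * Normal laws *)

(** Raise [v / k <= expR (v / k)] to the power [k]. *)
Lemma exprn_le_expR (R : realType) (k : nat) (v : R) : 0 <= v ->
  v ^+ k <= k%:R ^+ k * expR v.
Proof.
move=> v0; case: k => [|k]; first by rewrite !expr0 mul1r -expR0 ler_expR.
have k0 : 0 < k.+1%:R :> R by rewrite ltr0n.
have -> : expR v = expR (v / k.+1%:R) ^+ k.+1.
  by rewrite -expRM_natl mulrC divfK// gt_eqF.
rewrite -exprMn lerXn2r ?nnegrE ?mulr_ge0 ?expR_ge0//.
rewrite [leRHS]mulrC -ler_pdivrMr//.
by apply: le_trans (expR_ge1Dx _); rewrite lerDr.
Qed.

Section normal.
Context {R : realType}.
Local Notation mu := (@lebesgue_measure R).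
Implicit Types m s : R.

(** The Radon-Nikodym derivative and [normal_pdf] have the same integral on every measurable set,
    hence agree almost everywhere. *)
Lemma ge0_integral_normal_prob m s (f : R -> \bar R) : s != 0 ->
  measurable_fun setT f -> (forall x, 0 <= f x)%E ->
  (\int[normal_prob m s]_x f x = \int[mu]_x (f x * (normal_pdf m s x)%:E))%E.
Proof.
move=> s0 mf f0; have dom := normal_prob_dominates m s.
rewrite -(Radon_Nikodym_SigmaFinite.change_of_variables dom)//=.
have ig := Radon_Nikodym_SigmaFinite.f_integrable dom.
apply: ae_eq_integral => //.
- by apply: emeasurable_funM => //; exact: measurable_int ig.
- apply: emeasurable_funM => //=; apply/measurable_EFinP.
  exact: measurable_normal_pdf.
- apply: ae_eqe_mul2l; apply: integral_ae_eq => //=.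
  + by apply/measurable_EFinP; exact: measurable_normal_pdf.
  + by move=> E _ mE; rewrite -Radon_Nikodym_SigmaFinite.f_integral.
Qed.

(** Half of the Gaussian exponent, [v], absorbs the polynomial; the other half is the exponent of
    the density with deviation [Num.sqrt 2 * s]. Moments are thus bounded by integrating a
    density. *)
Lemma normal_pdf_domination (k : nat) m s x : 0 < s ->
  (x - m) ^+ (2 * k) * normal_pdf m s x <=
  (4 ^+ k * k%:R ^+ k * Num.sqrt 2) * s ^+ (2 * k) * normal_pdf m (Num.sqrt 2 *
    s) x.
Proof.
move=> s0.
have r2 : 0 < Num.sqrt 2 :> R by rewrite sqrtr_gt0.
rewrite !normal_pdfE ?mulf_neq0 ?gt_eqF//.
rewrite /normal_fun /normal_peak.
have -> : Num.sqrt ((Num.sqrt 2 * s) ^+ 2 * pi *+ 2) =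
    Num.sqrt 2 * Num.sqrt (s ^+ 2 * pi *+ 2).
  by rewrite exprMn sqr_sqrtr// -mulrA -mulrnAr sqrtrM.
set p := Num.sqrt (_ *+ 2).
pose v := (x - m) ^+ 2 / (4 * s ^+ 2).
have v0 : 0 <= v by rewrite divr_ge0 ?sqr_ge0// mulr_ge0 ?sqr_ge0.
have -> : - (x - m) ^+ 2 / (s ^+ 2 *+ 2) = - v + - v.
  by rewrite /v; field; rewrite gt_eqF.
have -> : - (x - m) ^+ 2 / ((Num.sqrt 2 * s) ^+ 2 *+ 2) = - v.
  by rewrite /v exprMn sqr_sqrtr//; field; rewrite gt_eqF.
have -> : (x - m) ^+ (2 * k) = 4 ^+ k * s ^+ (2 * k) * v ^+ k.
  rewrite !exprM -!exprMn /v; congr (_ ^+ _); field.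
  by rewrite gt_eqF.
rewrite expRD invfM.
rewrite [leRHS](_ : _ = 4 ^+ k * s ^+ (2 * k) * p^-1 * expR (- v) * k%:R ^+ k);
  last first.
  by field; rewrite ?(gt_eqF r2)// gt_eqF// sqrtr_gt0 pmulrn_lgt0// mulr_gt0
    ?exprn_gt0 ?pi_gt0.
rewrite [leLHS](_ : _ = 4 ^+ k * s ^+ (2 * k) * p^-1 * expR (- v) * (v ^+ k *
  expR (- v))); last by ring.
apply: ler_wpM2l.
  by rewrite !mulr_ge0 ?exprn_ge0 ?invr_ge0 ?sqrtr_ge0 ?expR_ge0// ltW.
by rewrite expRN ler_pdivrMr ?expR_gt0// exprn_le_expR.
Qed.

Lemma normal_moment_le (k : nat) : exists2 C : R, 0 <= C & forall m s, 0 < s ->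
  (\int[normal_prob m s]_x ((x - m) ^+ (2 * k))%:E <= (C * s ^+ (2 * k))%:E)%E.
Proof.
exists (4 ^+ k * k%:R ^+ k * Num.sqrt 2).
  by rewrite !mulr_ge0 ?exprn_ge0 ?sqrtr_ge0.
move=> m s s0; set C := _ * Num.sqrt 2.
have C0 : 0 <= C by rewrite !mulr_ge0 ?exprn_ge0 ?sqrtr_ge0.
have ev x : 0 <= (x - m) ^+ (2 * k) by rewrite exprM exprn_ge0// sqr_ge0.
have mf : measurable_fun [set: R] (fun x => (x - m) ^+ (2 * k)).
  by apply: measurable_funX; exact: measurable_funB.
rewrite ge0_integral_normal_prob ?gt_eqF//; last exact/measurable_EFinP.
have s'0 : 0 < Num.sqrt 2 * s by rewrite mulr_gt0// sqrtr_gt0.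
apply: (@le_trans _ _ (\int[mu]_x ((C * s ^+ (2 * k))%:E *
    (normal_pdf m (Num.sqrt 2 * s) x)%:E))%E).
  apply: ge0_le_integral => //=.
  - by move=> x _; rewrite -EFinM lee_fin mulr_ge0// normal_pdf_ge0.
  - apply/measurable_EFinP; apply: measurable_funM => //.
    exact: measurable_normal_pdf.
  - apply/measurable_EFinP; apply: measurable_funM => //.
    exact: measurable_normal_pdf.
  - by move=> x _; rewrite -!EFinM lee_fin normal_pdf_domination.
rewrite ge0_integralZl//=.
- by rewrite integral_normal_pdf mule1.
- by apply/measurable_EFinP; exact: measurable_normal_pdf.
- by move=> x _; rewrite lee_fin normal_pdf_ge0.
- by rewrite lee_fin mulr_ge0// exprn_ge0// ltW.
Qed.

(** The density is at most [(2 * s)^-1], since [2 <= pi], and the interval has length [2 * a]. *)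
Lemma normal_small_ball m s a : 0 < s -> 0 < a ->
  (normal_prob m s [set x | (`|x| <= a)%R] * s%:E <= a%:E)%E.
Proof.
move=> s0 a0.
have -> : [set x : R | `|x| <= a] = `[(- a), a]%classic.
  by apply/seteqP; split => x /=; rewrite in_itv/= ler_norml.
apply: (@le_trans _ _ ((a / s)%:E * s%:E)%E); last first.
  by rewrite -EFinM divfK// gt_eqF.
apply: lee_wpmul2r; first by rewrite lee_fin ltW.
rewrite /normal_prob; set A := `[(- a), a]%classic.
have mA : measurable (A : set (measurableTypeR R)) by exact: measurable_itv.
apply: (@le_trans _ _ (\int[mu]_(x in A) (cst (2 * s)^-1%:E) x)%E).
  apply: ge0_le_integral => //=.
  - by move=> x _; rewrite lee_fin normal_pdf_ge0.
  - by apply/measurable_EFinP/measurable_funTS; exact: measurable_normal_pdf.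
  - move=> x _; rewrite lee_fin.
    apply: le_trans (normal_pdf_ub _ _ _) _; first by rewrite gt_eqF.
    rewrite /normal_peak lef_pV2 ?posrE ?mulr_gt0//; last first.
      by rewrite sqrtr_gt0 pmulrn_lgt0// mulr_gt0 ?exprn_gt0 ?pi_gt0.
    rewrite -[leLHS]gtr0_norm ?mulr_gt0// -sqrtr_sqr ler_sqrt.
      rewrite exprMn mulrC -mulrnAr ler_pM2l ?exprn_gt0//.
      by have := @pi_ge2 R; lra.
    by rewrite pmulrn_lge0// mulr_ge0 ?sqr_ge0 ?pi_ge0.
rewrite integral_cst//= /A lebesgue_measure_itv/= lte_fin.
rewrite ifT; last by lra.
rewrite -EFinD -EFinM lee_fin le_eqVlt; apply/orP; left; apply/eqP.
by field; rewrite gt_eqF.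
Qed.

End normal.

(** * Gaussian variables *)

Lemma exprDn_le (R : realFieldType) (x y : R) k : 0 <= x -> 0 <= y ->
  (x + y) ^+ k <= 2 ^+ k * (x ^+ k + y ^+ k).
Proof.
wlog xy : x y / x <= y => [th x0 y0|x0 y0].
  have [xy|/ltW yx] := leP x y; first exact: th.
  by rewrite addrC [x ^+ k + _]addrC th.
apply: (@le_trans _ _ ((2 * y) ^+ k)).
  by rewrite lerXn2r ?nnegrE ?addr_ge0 ?mulr_ge0//; lra.
by rewrite exprMn ler_wpM2l ?exprn_ge0// lerDr exprn_ge0.
Qed.

Section gaussian_variables.
Context d (T : measurableType d) (R : realType) (P : probability T R).
Implicit Types (Y : T -> R) (m s : R).

Lemma integral_le_lincomb (f g h : T -> R) (a b : R) :
  measurable_fun [set: T] f -> measurable_fun [set: T] g ->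
  measurable_fun [set: T] h -> (forall w, 0 <= f w) -> (forall w, 0 <= g w) ->
  (forall w, 0 <= h w) -> 0 <= a -> 0 <= b ->
  (forall w, f w <= a * g w + b * h w) ->
  (\int[P]_w (f w)%:E <=
   a%:E * \int[P]_w (g w)%:E + b%:E * \int[P]_w (h w)%:E)%E.
Proof.
move=> mf mg mh f0 g0 h0 a0 b0 fgh.
rewrite -!ge0_integralZl//; [|exact/measurable_EFinP|
  by move=> w _; rewrite lee_fin|exact/measurable_EFinP|
  by move=> w _; rewrite lee_fin].
rewrite -ge0_integralD//; [|by move=> w _; rewrite -EFinM lee_fin mulr_ge0
  |by apply/measurable_EFinP; apply: measurable_funM
  |by move=> w _; rewrite -EFinM lee_fin mulr_ge0
  |by apply/measurable_EFinP; apply: measurable_funM].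
apply: ge0_le_integral => //=.
- by move=> w _; rewrite lee_fin.
- exact/measurable_EFinP.
- apply/measurable_EFinP; apply: measurable_funD; exact: measurable_funM.
- by move=> w _; rewrite -!EFinM -EFinD lee_fin.
Qed.

Lemma integral_cst_prob (c : R) : (\int[P]_w c%:E = c%:E)%E.
Proof.
rewrite integral_cst// -[RHS]mule1; congr (_ * _)%E.
exact: probability_setT.
Qed.

Lemma integral_indic_fine (A : set T) : measurable A ->
  (\int[P]_w (\1_A w)%:E = (fine (P A))%:E)%E.
Proof.
move=> mA; rewrite integral_indic// setIT; apply: esym; apply: fineK.
exact: fin_num_measure.
Qed.

Definition gaussian_law Y m s : Prop :=
  [/\ measurable_fun [set: T] Y, 0 <= s &
    forall A : set R, measurable A ->
      P (Y @^-1` A) = if s == 0 then \d_m A else normal_prob m s A].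

Lemma ge0_integral_gaussian_law Y m s (f : R -> \bar R) : gaussian_law Y m s ->
  measurable_fun [set: R] f -> (forall x, 0 <= f x)%E ->
  (\int[P]_w f (Y w) =
    if (s == 0)%R then f m else \int[normal_prob m s]_x f x)%E.
Proof.
move=> [mY s0 hY] mf f0.
pose Y' : T -> measurableTypeR R := Y.
have mY' : measurable_fun setT Y' by exact: mY.
transitivity (\int[pushforward P Y']_y f y)%E.
  by rewrite ge0_integral_pushforward.
case: ifP hY => s00 hY.
  rewrite (eq_measure_integral \d_(m : measurableTypeR R)).
    by rewrite integral_dirac// diracT mul1e.
  by move=> A mA _; exact: hY.
by apply: (eq_measure_integral (normal_prob m s)) => A mA _; exact: hY.
Qed.

Lemma gaussian_law_moment k : exists2 C : R, 0 <= C & forall Y m s,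
  gaussian_law Y m s ->
  (\int[P]_w ((Y w - m) ^+ (2 * k))%:E <= (C * s ^+ (2 * k))%:E)%E.
Proof.
have [C C0 hC] := normal_moment_le (R := R) k.
(* The added 1 covers a point mass with [k = 0], where the moment is [0 ^+ 0 = 1]. *)
exists (C + 1) => [|Y m s hY]; first by rewrite addr_ge0.
have [_ s0 _] := hY.
have mf : measurable_fun [set: R] (fun x => ((x - m) ^+ (2 * k))%:E).
  by apply/measurable_EFinP; apply: measurable_funX; exact: measurable_funB.
have f0 x : (0 <= ((x - m) ^+ (2 * k))%:E)%E.
  by rewrite lee_fin exprM exprn_ge0// sqr_ge0.
rewrite (ge0_integral_gaussian_law hY mf f0).
have sk : 0 <= s ^+ (2 * k) by rewrite exprn_ge0.
case: eqVneq => [->|sn0].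
  by rewrite subrr lee_fin mulrDl mul1r lerDr mulr_ge0// exprn_ge0.
apply: (le_trans (hC m s _)); first by rewrite lt_neqAle eq_sym sn0.
by rewrite lee_fin mulrDl mul1r lerDl.
Qed.

(** Multiplying by [s], instead of dividing the right side by it, keeps the bound valid for point
    masses. *)
Lemma gaussian_law_small_ball Y m s (a : R) : gaussian_law Y m s -> 0 < a ->
  (P [set w | (`|Y w| <= a)%R] * s%:E <= a%:E)%E.
Proof.
move=> [mY s0 hY] a0.
rewrite (_ : [set w | _] = Y @^-1` [set x | `|x| <= a])//.
have mA : measurable [set x : R | `|x| <= a].
  rewrite (_ : mkset _ = `[(- a), a]%classic); first exact: measurable_itv.
  by apply/seteqP; split => x /=; rewrite in_itv/= ler_norml.
rewrite hY//; case: eqVneq => [->|sn0]; first by rewrite mule0 lee_fin ltW.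
by apply: normal_small_ball => //; rewrite lt_neqAle eq_sym sn0.
Qed.

Lemma measurable_abs_le Y (a : R) : measurable_fun [set: T] Y ->
  measurable [set w | `|Y w| <= a].
Proof.
move=> mY; rewrite -[X in measurable X]setTI.
rewrite (_ : [set w | _] = (fun w => `|Y w|) @^-1` `]-oo, a]).
  have mnY : measurable_fun [set: T] (fun w => `|Y w|) by exact:
    measurableT_comp.
  exact: mnY.
by apply/seteqP; split => w /=; rewrite in_itv.
Qed.

Let meas_sub Y m k : measurable_fun [set: T] Y ->
  measurable_fun [set: T] (fun w => (Y w - m) ^+ k).
Proof.
by move=> mY; apply: measurable_funX; apply: measurable_funB.
Qed.

Let ev0 (x : R) k : 0 <= x ^+ (2 * k).
Proof. by rewrite exprM exprn_ge0// sqr_ge0. Qed.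

Lemma gaussian_moment_upper : exists2 C : R, 0 <= C & forall Y m s,
  gaussian_law Y m s ->
  (\int[P]_w ((Y w) ^+ 2)%:E <= (C * s ^+ 2 + 2 * m ^+ 2)%:E)%E.
Proof.
have [C C0 hC] := gaussian_law_moment 1.
exists (2 * C) => [|Y m s hY]; first by rewrite mulr_ge0.
have [mY _ _] := hY.
have := @integral_le_lincomb (fun w => Y w ^+ 2) (fun w => (Y w - m) ^+ 2)
  (fun w => m ^+ 2) 2 2.
have -> : (\int[P]_w (m ^+ 2)%:E = (m ^+ 2)%:E)%E by exact: integral_cst_prob.
move=> /(_ (measurable_funX _ mY) (meas_sub _ _ mY) (measurable_cst _)).
move=> h; apply: (le_trans (h _ _ _ _ _ _)) => //.
- by move=> w; exact: sqr_ge0.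
- by move=> w; exact: sqr_ge0.
- by move=> w; exact: sqr_ge0.
- by move=> w; rewrite -subr_ge0 [X in 0 <= X](_ : _ = (Y w - 2 * m) ^+ 2)
  ?sqr_ge0//; ring.
- rewrite [leRHS]EFinD; apply: leeD; last by rewrite EFinM.
  by rewrite -mulrA EFinM lee_wpmul2l//; exact: hC hY.
Qed.

Lemma gaussian_integral_sqr_fin Y : gaussian_rv P Y ->
  (\int[P]_w ((Y w) ^+ 2)%:E)%E \is a fin_num.
Proof.
move=> [mY [m [s [s0 hY]]]].
have [C C0 hC] := gaussian_moment_upper.
have h := hC Y m s (And3 mY s0 hY).
rewrite ge0_fin_numE; first exact: le_lt_trans h (ltry _).
by apply: integral_ge0 => w _; rewrite lee_fin sqr_ge0.
Qed.

(* The small-ball bound at radius [s / 2] gives [s^2 <= 8 E Y^2]; the mean is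
   then controlled by averaging [m^2 <= 2 (Y - m)^2 + 2 Y^2]. *)
Lemma gaussian_params_le : exists2 C : R, 0 <= C & forall Y m s,
  gaussian_law Y m s ->
  ((m ^+ 2 + s ^+ 2)%:E <= C%:E * \int[P]_w ((Y w) ^+ 2)%:E)%E.
Proof.
have [C C0 hC] := gaussian_law_moment 1.
exists (2 * C * 8 + 2 + 8) => [|Y m s hY]; first by rewrite !addr_ge0 ?mulr_ge0.
have [mY s0 hP] := hY.
have eq0 w : 0 <= Y w ^+ 2 by rewrite sqr_ge0.
have mY2 : measurable_fun [set: T] (fun w => Y w ^+ 2) by apply:
  measurable_funX.
have := gaussian_integral_sqr_fin (conj mY (ex_intro _ m (ex_intro _ s (conj s0
  hP)))).
set I := (\int[P]_w _)%E => fI; rewrite -(fineK fI); set e := fine I.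
have e0 : 0 <= e by rewrite fine_ge0// integral_ge0// => w _; rewrite lee_fin.
have hs : s ^+ 2 <= 8 * e.
  have [->|sn0] := eqVneq s 0; first by rewrite expr0n/= mulr_ge0.
  have sp : 0 < s by rewrite lt_neqAle eq_sym sn0.
  have mA := measurable_abs_le (s / 2) mY.
  have := gaussian_law_small_ball hY (divr_gt0 sp (ltr0n R 2)).
  set A := [set w | _] => /=.
  have fA : P A \is a fin_num by exact: fin_num_measure.
  rewrite -(fineK fA) -EFinM lee_fin; set p := fine _ => hp.
  (* Off [A] the square of [Y] exceeds [s ^+ 2 / 4], and [A] has probability at most 1/2; hence
     [s ^+ 2 / 8 <= e]. *)
  have := @integral_le_lincomb (fun w => s ^+ 2 / 4) (fun w => Y w ^+ 2)
    (fun w => \1_A w) 1 (s ^+ 2 / 4).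
  rewrite (integral_indic_fine mA) -/p -/I -(fineK fI) -/e.
  rewrite integral_cst_prob -!EFinM -EFinD lee_fin => h.
  have {}h : s ^+ 2 / 4 <= 1 * e + s ^+ 2 / 4 * p.
    apply: h => //; rewrite ?divr_ge0 ?sqr_ge0//.
      exact: measurable_indic.
    move=> w; rewrite mul1r indicE; case: (boolP (w \in A)) => wA /=.
      by rewrite mulr1 lerDr.
    rewrite mulr0 addr0; move: wA; rewrite notin_setE /A/= => /negP.
    rewrite -ltNge => h'; rewrite -(real_normK (num_real (Y w))).
    rewrite (_ : s ^+ 2 / 4 = (s / 2) ^+ 2); last by field.
    by rewrite lerXn2r ?nnegrE// ?divr_ge0 // ltW.
  have : s / 4 * (p * s) <= s / 4 * (s / 2) by rewrite ler_wpM2l// divr_ge0.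
  nra.
have hm : m ^+ 2 <= 2 * (C * s ^+ 2) + 2 * e.
  have := @integral_le_lincomb (fun w => m ^+ 2) (fun w => (Y w - m) ^+ 2)
    (fun w => Y w ^+ 2) 2 2.
  rewrite integral_cst_prob -/I -(fineK fI) -/e => h.
  rewrite -lee_fin [leRHS]EFinD; apply: (le_trans (h _ _ _ _ _ _ _ _ _)) => //.
  - exact: meas_sub.
  - by move=> w; exact: sqr_ge0.
  - by move=> w; exact: sqr_ge0.
  - by move=> w; rewrite -subr_ge0 [X in 0 <= X](_ : _ = (2 * Y w - m) ^+ 2)
    ?sqr_ge0//; ring.
  - by apply: leeD; rewrite EFinM// lee_wpmul2l//; exact: hC hY.
rewrite -EFinM lee_fin.
have : 2 * C * s ^+ 2 <= 2 * C * (8 * e) by rewrite ler_wpM2l// mulr_ge0.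
lra.
Qed.

(** Equivalence of Gaussian moments without centring: [(Y - m) ^+ (2 * k)] and [m ^+ (2 * k)] are
    integrated separately, and both [s ^+ 2] and [m ^+ 2] are controlled by the second moment. *)
Lemma gaussian_moment_le k : exists2 C : R, 0 <= C & forall Y, gaussian_rv P Y
  ->
  (\int[P]_w ((Y w) ^+ (2 * k))%:E <=
    (C * fine (\int[P]_w ((Y w) ^+ 2)%:E) ^+ k)%:E)%E.
Proof.
have [C C0 hC] := gaussian_law_moment k.
have [D D0 hD] := gaussian_params_le.
exists (4 ^+ k * (C + 1) * D ^+ k) => [|Y gY].
  by rewrite !mulr_ge0 ?exprn_ge0 ?addr_ge0.
have [mY [m [s [s0 hP]]]] := gY.
have hY : gaussian_law Y m s by [].
have := hD Y m s hY; have := gaussian_integral_sqr_fin gY.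
set I := (\int[P]_w (Y w ^+ 2)%:E)%E => fI; rewrite -{1}(fineK fI).
set e := fine I; rewrite lee_fin => hms.
have m2 := sqr_ge0 m; have s2 := sqr_ge0 s.
have := @integral_le_lincomb (fun w => Y w ^+ (2 * k)) (fun w => (Y w - m) ^+
  (2 * k))
    (fun w => m ^+ (2 * k)) (4 ^+ k) (4 ^+ k).
rewrite integral_cst_prob => h.
apply: (le_trans (h _ _ _ _ _ _ _ _ _)) => //.
- exact: measurable_funX.
- exact: meas_sub.
- move=> w; rewrite !exprM.
  apply: (@le_trans _ _ ((2 * (Y w - m) ^+ 2 + 2 * m ^+ 2) ^+ k)).
    apply: lerXn2r; rewrite ?nnegrE ?sqr_ge0//.
      by rewrite addr_ge0// mulr_ge0// sqr_ge0.
    by rewrite -subr_ge0 [X in 0 <= X](_ : _ = (Y w - 2 * m) ^+ 2) ?sqr_ge0//;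
      ring.
  have q (x : R) : 0 <= 2 * x ^+ 2 by rewrite mulr_ge0// sqr_ge0.
  apply: (le_trans (exprDn_le _ (q _) (q _))).
  by rewrite ![(2 * _ ^+ 2) ^+ k]exprMn -!mulrDr mulrA -exprMn -natrM.
apply: (@le_trans _ _ ((4 ^+ k)%:E * (C * s ^+ (2 * k))%:E + (4 ^+ k)%:E * (m
  ^+ (2 * k))%:E)%E).
  by apply: leeD => //; rewrite lee_wpmul2l ?lee_fin ?exprn_ge0//; exact: hC hY.
rewrite -!EFinM -EFinD lee_fin -!mulrA -mulrDr ler_wpM2l ?exprn_ge0//.
rewrite -exprMn mulrDl mul1r; apply: lerD.
  rewrite ler_wpM2l// exprM lerXn2r ?nnegrE//; first by rewrite (le_trans _
    hms)// addr_ge0.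
  by rewrite (le_trans _ hms)// lerDr.
rewrite exprM lerXn2r ?nnegrE//; first by rewrite (le_trans _ hms)// addr_ge0.
by rewrite (le_trans _ hms)// lerDl.
Qed.

(** A Gaussian variable staying in a window with probability at least [c] has both parameters of the
    order of the window: the small-ball bound gives [s <= a / c], then the mean follows. [C] depends
    on [c] only, so it serves all increments at once. *)
Lemma gaussian_second_moment_le (c : R) : 0 < c -> exists2 C : R, 0 <= C &
  forall Y (a : R), gaussian_rv P Y -> 0 < a -> (c%:E <= P [set w | (`|Y w| <=
    a)%R])%E ->
  (\int[P]_w ((Y w) ^+ 2)%:E <= (C * a ^+ 2)%:E)%E.
Proof.
move=> c0; have [C C0 hC] := gaussian_law_moment 1.
have [D D0 hD] := gaussian_moment_upper.
exists (D / c ^+ 2 + 2 * ((2 * C / c ^+ 2 + 2) / c)).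
  have c2 : 0 <= c ^+ 2 := sqr_ge0 c; have c0' := ltW c0.
  rewrite addr_ge0//; first exact: divr_ge0.
  by rewrite mulr_ge0// divr_ge0// addr_ge0// divr_ge0// mulr_ge0.
move=> Y a [mY [m [s [s0 hP]]]] a0.
have hY : gaussian_law Y m s by [].
have mA := measurable_abs_le a mY.
have := gaussian_law_small_ball hY a0.
set A := [set w | _] => /=.
have fA : P A \is a fin_num by exact: fin_num_measure.
rewrite -(fineK fA) -EFinM !lee_fin; set p := fine _ => hp cp.
have sa : s <= a / c.
  rewrite ler_pdivlMr// mulrC; apply: le_trans hp.
  by rewrite ler_wpM2r.
have sa2 : s ^+ 2 <= a ^+ 2 / c ^+ 2.
  by rewrite -expr_div_n lerXn2r ?nnegrE ?divr_ge0// ltW.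
(* Average [m ^+ 2 <= 2 * (Y - m) ^+ 2 + 2 * Y ^+ 2] over the event [A], on which
   [Y ^+ 2 <= a ^+ 2]. *)
have hm : m ^+ 2 * c <= 2 * C * s ^+ 2 + 2 * a ^+ 2.
  have := @integral_le_lincomb (fun w => m ^+ 2 * \1_A w) (fun w => (Y w - m)
    ^+ 2)
    (fun w => a ^+ 2) 2 2.
  rewrite integral_cst_prob => h.
  have : ((m ^+ 2 * p)%:E <= (2 * C * s ^+ 2 + 2 * a ^+ 2)%:E)%E.
    have -> : ((m ^+ 2 * p)%:E = \int[P]_w (m ^+ 2 * \1_A w)%:E)%E.
      under eq_integral do rewrite EFinM.
      rewrite ge0_integralZl//.
      - by rewrite (integral_indic_fine mA).
      - by apply/measurable_EFinP; exact: measurable_indic.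
      - by rewrite lee_fin sqr_ge0.
    apply: (le_trans (h _ _ _ _ _ _ _ _ _)) => //.
    - by apply: measurable_funM => //; exact: measurable_indic.
    - exact: meas_sub.
    - by move=> w; rewrite mulr_ge0 ?sqr_ge0.
    - by move=> w; exact: sqr_ge0.
    - by move=> w; exact: sqr_ge0.
    - move=> w; rewrite indicE; case: (boolP (w \in A)) => wA /=; last first.
        by rewrite mulr0 addr_ge0// mulr_ge0// sqr_ge0.
      move: wA; rewrite inE /A/= mulr1 => wA.
      have : Y w ^+ 2 <= a ^+ 2.
        by rewrite -(real_normK (num_real (Y w))) lerXn2r ?nnegrE// ltW.
      by have := sqr_ge0 (2 * Y w - m); clear h; lra.
    - rewrite [leRHS]EFinD; apply: leeD; last by rewrite EFinM.
  by rewrite -mulrA EFinM lee_wpmul2l//; exact: hC hY.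
  rewrite lee_fin; apply: le_trans.
  by rewrite ler_wpM2l// sqr_ge0.
apply: (le_trans (hD Y m s hY)); rewrite lee_fin [leRHS]mulrDl; apply: lerD.
  by rewrite -mulrA (mulrC _ (a ^+ 2)) ler_wpM2l.
rewrite -mulrA ler_wpM2l// mulrAC ler_pdivlMr//; apply: (le_trans hm).
rewrite [leRHS]mulrDl; apply: lerD => //.
by rewrite -!mulrA !ler_wpM2l// mulrC.
Qed.

End gaussian_variables.

(** * From paths to second moments *)

(** Intersect covers of probability below [1 / (k + 1)]. Measurability of [A] is not assumed, as [A]
    will be a condition on uncountably many increments. *)
Lemma negligible_small d (T : measurableType d) (R : realType)
    (P : probability T R) (A : set T) :
  (forall c : R, 0 < c ->
    exists B, [/\ measurable B, A `<=` B & (P B < c%:E)%E]) ->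
  P.-negligible A.
Proof.
move=> h.
have /choice[B hB] k : exists B, [/\ measurable B, A `<=` B &
    (P B < (k.+1%:R^-1 : R)%:E)%E] by apply: h; rewrite invr_gt0.
have mB k : measurable (B k) by have [] := hB k.
exists (\bigcap_k B k); split.
- exact: bigcap_measurable.
- apply/eqP; rewrite eq_le measure_ge0 andbT.
  apply/lee_addgt0Pr => e e0; rewrite add0e.
  pose k := Num.truncn e^-1.
  apply: (@le_trans _ _ (P (B k))).
    apply: le_measure; rewrite ?inE//; last by move=> w; exact.
    exact: bigcap_measurable.
  have [_ _ /ltW/le_trans] := hB k; apply.
  rewrite lee_fin invf_ple ?posrE//.
  by rewrite ltW// truncnS_gt.
- by move=> w Aw k _; have [_ + _] := hB k; exact.
Qed.

Section gaussian_increments.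
Context {R : realType} {N : nat} {nrm : 'rV[R]_N -> R}.
Hypothesis hnrm : is_norm nrm.
Context d (T : measurableType d) (P : probability T R).
Variable X : 'rV[R]_N -> T -> R.
Hypothesis hgauss : gaussian_process P X.
Variable t0 : 'rV[R]_N.
Implicit Types t u : 'rV[R]_N.

Lemma gaussian_increment t u : orthant R N t -> orthant R N u ->
  gaussian_rv P (fun w => X t w - X u w).
Proof.
move=> ot ou.
have := @hgauss 2 (fun i => if i == 0 then t else u) (fun i => if i == 0 then 1
  else -1).
under eq_fun do rewrite big_ord_recl big_ord1 /= mul1r mulN1r.
by apply=> i; case: ifP.
Qed.

Definition L2_increment t u : R :=
  Num.sqrt (fine (\int[P]_w ((X t w - X u w) ^+ 2)%:E)).

Let g := L2_increment.

Lemma L2_increment_ge0 t u : 0 <= g t u.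
Proof. exact: sqrtr_ge0. Qed.

Let int_ge0 t u : (0 <= \int[P]_w ((X t w - X u w) ^+ 2)%:E)%E.
Proof. by apply: integral_ge0 => w _; rewrite lee_fin sqr_ge0. Qed.

Lemma L2_increment_sqr t u :
  g t u ^+ 2 = fine (\int[P]_w ((X t w - X u w) ^+ 2)%:E).
Proof. by rewrite sqr_sqrtr// fine_ge0. Qed.

Lemma L2_incrementE t u : orthant R N t -> orthant R N u ->
  (\int[P]_w ((X t w - X u w) ^+ 2)%:E = (g t u ^+ 2)%:E)%E.
Proof.
move=> ot ou; rewrite L2_increment_sqr fineK//.
exact: gaussian_integral_sqr_fin (gaussian_increment ot ou).
Qed.

Lemma L2_increment_expectation t u : orthant R N t -> orthant R N u ->
  ('E_P[(fun w => (X t w - X u w) ^+ 2)%R] = (g t u ^+ 2)%:E)%E.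
Proof. by move=> ot ou; rewrite unlock; exact: L2_incrementE. Qed.

Lemma L2_increment_refl t : g t t = 0.
Proof.
rewrite /g /L2_increment; under eq_integral do rewrite subrr expr0n.
by rewrite integral0 sqrtr0.
Qed.

(** Integrating [(x - y)^2 <= 2 x^2 + 2 y^2] replaces Minkowski's inequality; a constant 2 is
    harmless for [admissible_nonpos]. *)
Lemma L2_increment_quasi_triangle t u : orthant R N t0 ->
  orthant R N t -> orthant R N u -> g t u <= 2 * (g t t0 + g u t0).
Proof.
move=> o0 ot ou.
have m a b : orthant R N a -> orthant R N b ->
    measurable_fun [set: T] (fun w => (X a w - X b w) ^+ 2).
  by move=> oa ob; apply: measurable_funX; have [] := gaussian_increment oa ob.
have := @integral_le_lincomb _ T R P _ _ _ 2 2 (m _ _ ot ou) (m _ _ ot o0) (m _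
  _ ou o0).
rewrite !L2_incrementE// -!EFinM -EFinD lee_fin => h.
rewrite -ler_sqr ?nnegrE ?mulr_ge0 ?addr_ge0 ?L2_increment_ge0//.
have h1 : g t u ^+ 2 <= 2 * g t t0 ^+ 2 + 2 * g u t0 ^+ 2.
  apply: h => //; try by move=> w; exact: sqr_ge0.
  move=> w; rewrite -subr_ge0 [X in 0 <= X](_ : _ = (X t w + X u w - 2 * X t0
    w) ^+ 2) ?sqr_ge0//.
  ring.
have a0 := L2_increment_ge0 t t0; have b0 := L2_increment_ge0 u t0.
have ab0 := mulr_ge0 a0 b0; rewrite -/g in a0 b0 ab0.
apply: (le_trans h1); rewrite exprMn sqrrD.
have := sqr_ge0 (g t t0); have := sqr_ge0 (g u t0).
by move: (g t t0) (g u t0) ab0 => a b ab0 a2 b2; lra.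
Qed.

Lemma admissible_path_L2 s' sigma : {ae P, forall w,
  admissible (nrm := nrm) t0 (fun t u => `|X t w - X u w|) s' sigma ->
  admissible (nrm := nrm) t0 g s' sigma}.
Proof.
have [adm|nadm] := pselect (admissible (nrm := nrm) t0 g s' sigma).
  by apply: aeW.
(* One integer governs both the radius and the constant, so the admissible paths lie in the union of
   the [A n]. *)
pose A n := [set w | microlocal_bound (nrm := nrm) t0
  (fun t u => `|X t w - X u w|) s' sigma n.+1%:R^-1 n.+1%:R].
apply: (@negligibleS _ _ _ _ (\bigcup_n A n)).
  move=> w /= /not_implyP[[delta [C [d0 C0 h]]] _].
  pose n := maxn (Num.truncn delta^-1) (Num.truncn C).
  have hn1 : delta^-1 <= n.+1%:R.
    rewrite (le_trans (ltW (truncnS_gt _)))// ler_nat ltnS leq_maxl//.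
  have hn2 : C <= n.+1%:R.
    rewrite (le_trans (ltW (truncnS_gt _)))// ler_nat ltnS leq_maxr//.
  exists n => // rho t u r0 rd Bt Bu tu.
  apply: (le_trans (h rho t u r0 _ Bt Bu tu)).
    by rewrite (lt_le_trans rd)// invf_ple ?posrE.
  by rewrite ler_wpM2r// mulr_ge0 ?powR_ge0.
apply: negligible_bigcup => n; apply: negligible_small => c c0.
(* Otherwise every measurable set containing [A n] has probability at least [c]. The event that a
   single increment obeys its bound is such a set, which bounds each second moment and contradicts
   [nadm]. *)
apply: contrapT => hc; apply: nadm.
have [C C0 hC] := gaussian_second_moment_le P c0.
exists n.+1%:R^-1, (Num.sqrt C * n.+1%:R); split.
- by rewrite invr_gt0.
- by rewrite mulr_ge0 ?sqrtr_ge0.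
move=> rho t u r0 rd Bt Bu tu.
pose a := n.+1%:R * (nrm (t - u) `^ sigma * rho `^ (- s')).
have a0 : 0 < a by rewrite !mulr_gt0 ?powR_gt0// (oball_dist_gt0 hnrm).
have gY := gaussian_increment Bt.1 Bu.1.
have [mY _] := gY.
have := hC _ a gY a0; rewrite L2_incrementE ?lee_fin; [|exact: Bt.1|exact:
  Bu.1].
move=> h; rewrite -mulrA -/a -ler_sqr ?nnegrE ?mulr_ge0 ?sqrtr_ge0
  ?L2_increment_ge0 ?powR_ge0//.
rewrite exprMn (sqr_sqrtr C0); apply: h.
rewrite leNgt; apply/negP => Pc; apply: hc.
exists [set w | `|X t w - X u w| <= a]; split => //.
  exact: measurable_abs_le.
by move=> w Aw /=; exact: (Aw rho).
Qed.

End gaussian_increments.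

(** * Chaining on dyadic grids *)

Section chaining.
Context {R : realType} {N : nat}.
Implicit Types x z : 'rV[R]_N.

Definition cube x : Prop := forall i, 0 <= x ord0 i <= 1.

Definition grid (n : nat) (a : 'I_N -> nat) : 'rV[R]_N :=
  \row_i ((a i)%:R / 2 ^+ n).

Definition neighbours (n : nat) (a b : 'I_N -> nat) : Prop :=
  forall i, [/\ (a i <= 2 ^ n)%N, (b i <= 2 ^ n)%N,
    (a i <= (b i).+1)%N & (b i <= (a i).+1)%N].

(** Rounding down reaches the index [2 ^ n] when a coordinate equals 1, so each side of the grid has
    [2 ^ n + 1] points. *)
Definition dyadic (n : nat) x : 'I_N -> nat :=
  fun i => Num.truncn (2 ^+ n * x ord0 i).

Let p2 n : 0 < 2 ^+ n :> R. Proof. by rewrite exprn_gt0. Qed.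

Lemma dyadic_itv n x i : cube x ->
  (dyadic n x i)%:R <= 2 ^+ n * x ord0 i < (dyadic n x i).+1%:R.
Proof.
move=> /(_ i)/andP[x0 x1]; apply: truncn_itv.
by rewrite mulr_ge0// ltW.
Qed.

Lemma dyadic_le n x i : cube x -> (dyadic n x i <= 2 ^ n)%N.
Proof.
move=> cx; rewrite -(ler_nat R) natrX.
have /andP[h _] := dyadic_itv n i cx; apply: (le_trans h).
have /andP[_ x1] := cx i.
by rewrite ler_piMr// ltW.
Qed.

Lemma dist_grid_dyadic n x : cube x -> `|x - grid n (dyadic n x)| <= 2 ^- n.
Proof.
move=> cx; apply: norm_rv_le => [|i]; first by rewrite invr_ge0 ltW.
rewrite !mxE; have /andP[h1 h2] := dyadic_itv n i cx.
rewrite ger0_norm.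
  rewrite lerBlDr -[X in X + _]mul1r -mulrDl ler_pdivlMr// mulrC.
  by rewrite (le_trans (ltW h2))// -natr1 addrC.
by rewrite subr_ge0 ler_pdivrMr// mulrC.
Qed.

Lemma grid_double n (a : 'I_N -> nat) : grid n.+1 (fun i => (a i).*2) = grid n
  a.
Proof.
apply/rowP => i; rewrite !mxE -mul2n natrM exprS.
by rewrite invfM mulrACA divff ?mul1r// pnatr_eq0.
Qed.

(** Successive roundings of [x] are compared on the finer grid: twice the old index differs from the
    new one by at most 1. *)
Lemma neighbours_double n x : cube x ->
  neighbours n.+1 (fun i => (dyadic n x i).*2) (dyadic n.+1 x).
Proof.
move=> cx i; have h1 := dyadic_le n i cx; have h2 := dyadic_le n.+1 i cx.
have /andP[k1 k2] := dyadic_itv n i cx.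
have /andP[k3 k4] := dyadic_itv n.+1 i cx.
rewrite exprS -mulrA in k3 k4.
have : ((dyadic n x i).*2 < (dyadic n.+1 x i).+1)%N.
  by rewrite -(ltr_nat R) -mul2n natrM (le_lt_trans _ k4)// ler_wpM2l.
have : (dyadic n.+1 x i < (dyadic n x i).+1.*2)%N.
  by rewrite -(ltr_nat R) -mul2n natrM (le_lt_trans k3)// ltr_pM2l.
by rewrite expnS in h2 *; split; lia.
Qed.

Lemma neighbours_close n x z : cube x -> cube z -> `|x - z| <= 2 ^- n ->
  neighbours n (dyadic n x) (dyadic n z).
Proof.
move=> cx cz xz i; have /andP[k1 k2] := dyadic_itv n i cx.
have /andP[k3 k4] := dyadic_itv n i cz.
have : `|2 ^+ n * x ord0 i - 2 ^+ n * z ord0 i| <= 1.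
  rewrite -mulrBr normrM gtr0_norm// -ler_pdivlMl// mulr1.
  apply: le_trans xz; have := coord_le_norm (x - z) i.
  by rewrite !mxE.
move: k1 k2 k3 k4; set x' := 2 ^+ n * x _ _; set z' := 2 ^+ n * z _ _.
move: x' z' => x' z' k1 k2 k3 k4; rewrite ler_norml => /andP[h1 h2].
split; [exact: dyadic_le|exact: dyadic_le| |]; rewrite -ltnS -(ltr_nat R)
  -natr1.
  by apply: (le_lt_trans k1); move: k4; rewrite -!natr1; lra.
by apply: (le_lt_trans k3); move: k2; rewrite -!natr1; lra.
Qed.

Variables (f : 'rV[R]_N -> R) (M b : R).
Hypotheses (M0 : 0 <= M) (b0 : 0 <= b) (b1 : b < 1).
Hypothesis cf : forall x, cube x -> forall e, 0 < e -> exists2 delta, 0 < delta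
  &
  forall z, `|x - z| < delta -> `|f x - f z| < e.
Hypothesis hf : forall n (p q : 'I_N -> nat), neighbours n p q ->
  `|f (grid n p) - f (grid n q)| <= M * b ^+ n.

Lemma chaining_step n x : cube x ->
  `|f (grid n (dyadic n x)) - f (grid n.+1 (dyadic n.+1 x))| <= M * b ^+ n.+1.
Proof.
by move=> cx; rewrite -grid_double; apply: hf; exact: neighbours_double.
Qed.

(** Sum the steps as a geometric series; the factor [1 - b] is kept on the left to avoid dividing
    during the induction. *)
Lemma chaining_telescope n m x : cube x ->
  `|f (grid n (dyadic n x)) - f (grid (n + m) (dyadic (n + m) x))| * (1 - b) <=
  M * b ^+ n.+1 * (1 - b ^+ m).
Proof.
move=> cx; elim: m => [|m IH].
  by rewrite addn0 subrr normr0 mul0r expr0 subrr mulr0.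
rewrite addnS; have h := chaining_step (n + m) cx.
have b1' : 0 <= 1 - b by rewrite subr_ge0 ltW.
have := ler_distD (f (grid (n + m) (dyadic (n + m) x))) (f (grid n (dyadic n
  x)))
  (f (grid (n + m).+1 (dyadic (n + m).+1 x))).
move=> /(ler_wpM2r b1')/le_trans; apply; rewrite mulrDl.
apply: (le_trans (lerD IH (ler_wpM2r b1' h))).
rewrite -addSn [b ^+ (n.+1 + m)]exprD [b ^+ m.+1]exprS.
by rewrite le_eqVlt; apply/orP; left; apply/eqP; ring.
Qed.

Lemma chaining_limit n x : cube x ->
  `|f x - f (grid n (dyadic n x))| * (1 - b) <= M * b ^+ n.+1.
Proof.
move=> cx; have b1' : 0 < 1 - b by rewrite subr_gt0.
apply/ler_addgt0Pr => e e0.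
have [delta d0 hd] := cf cx e0.
(* Deep enough for the grid point to be within [delta] of [x], where continuity applies. *)
pose m := Num.truncn delta^-1.
have hm : `|f x - f (grid (n + m) (dyadic (n + m) x))| < e.
  apply: hd; apply: (le_lt_trans (dist_grid_dyadic _ cx)).
  rewrite invf_plt ?posrE//; apply: (lt_le_trans (truncnS_gt _)).
  rewrite -natrX ler_nat; apply: (@leq_trans (n + m).+1).
    by rewrite ltnS leq_addl.
  exact: ltn_expl.
have h := chaining_telescope n m cx.
have := ler_distD (f (grid (n + m) (dyadic (n + m) x))) (f x)
  (f (grid n (dyadic n x))).
move=> /(ler_wpM2r (ltW b1'))/le_trans; apply; rewrite mulrDl addrC.
apply: lerD.
  rewrite distrC; apply: (le_trans h); rewrite ler_piMr//.
    by rewrite mulr_ge0// exprn_ge0.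
  by rewrite gerBl exprn_ge0.
by apply: (le_trans _ (ltW hm)); rewrite ler_piMr// gerBl.
Qed.

(** Go from [x] to its grid point, across to the neighbouring grid point of [z], and back to [z]. *)
Lemma chaining_bound n x z : cube x -> cube z -> `|x - z| <= 2 ^- n ->
  `|f x - f z| <= M * (1 + 2 / (1 - b)) * b ^+ n.
Proof.
move=> cx cz xz; have b1' : 0 < 1 - b by rewrite subr_gt0.
have hx := chaining_limit n cx; have hz := chaining_limit n cz.
have hn := hf (neighbours_close cx cz xz).
rewrite -!ler_pdivlMr// in hx hz.
have bn : M * b ^+ n.+1 / (1 - b) <= M * b ^+ n / (1 - b).
  rewrite ler_pM2r ?invr_gt0// ler_wpM2l// exprS ler_piMl ?exprn_ge0//.
  exact: ltW.
have -> : f x - f z = (f x - f (grid n (dyadic n x))) +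
  (f (grid n (dyadic n x)) - f (grid n (dyadic n z))) +
  (f (grid n (dyadic n z)) - f z) by ring.
apply: (le_trans (ler_normD _ _)).
apply: (@le_trans _ _ (M * b ^+ n / (1 - b) + M * b ^+ n + M * b ^+ n / (1 -
  b))).
  apply: lerD; last by rewrite distrC (le_trans hz).
  apply: (le_trans (ler_normD _ _)); apply: lerD => //.
  exact: le_trans hx bn.
rewrite le_eqVlt; apply/orP; left; apply/eqP; ring.
Qed.

End chaining.

Section chaining_hoelder.
Context {R : realType} {N : nat}.

Lemma chaining_hoelder (alpha : R) : 0 < alpha -> exists2 K : R, 0 <= K &
  forall (f : 'rV[R]_N -> R) (M : R), 0 <= M ->
  (forall x, cube x -> forall e, 0 < e -> exists2 delta, 0 < delta &
     forall z, `|x - z| < delta -> `|f x - f z| < e) ->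
  (forall n (p q : 'I_N -> nat), neighbours n p q ->
    `|f (grid n p) - f (grid n q)| <= M * (2 ^- n) `^ alpha) ->
  forall x z, cube x -> cube z -> `|f x - f z| <= K * M * `|x - z| `^ alpha.
Proof.
move=> a0; pose b : R := 2^-1 `^ alpha.
have b0 : 0 <= b by exact: powR_ge0.
have b1 : b < 1.
  have e1 : 1 `^ alpha = 1 :> R by rewrite powR1.
  by rewrite -e1; apply: gt0_ltr_powR; rewrite ?nnegrE ?invr_ge0// invf_lt1//
    ltr1n.
have bE n : (2 ^- n) `^ alpha = b ^+ n.
  by rewrite -powR_mulrn// /b -powRrM mulrC powRrM powR_mulrn ?invr_ge0//
    exprVn.
have K0 : 0 <= 1 + 2 / (1 - b) by rewrite addr_ge0// divr_ge0// subr_ge0 ltW.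
exists ((1 + 2 / (1 - b)) * 2 `^ alpha); first by rewrite mulr_ge0 ?powR_ge0.
move=> f M M0 cf hf x z cx cz.
have [->|xz] := eqVneq x z.
  by rewrite !subrr !normr0 !mulr_ge0 ?powR_ge0.
have hf' n (p q : 'I_N -> nat) : neighbours n p q ->
  `|f (grid n p) - f (grid n q)| <= M * b ^+ n by rewrite -bE; exact: hf.
pose D := `|x - z|; have D0 : 0 < D by rewrite normr_gt0 subr_eq0.
have D1 : D <= 1.
  apply: norm_rv_le => // i; rewrite !mxE ler_norml.
  by have /andP[? ?] := cx i; have /andP[? ?] := cz i; apply/andP; split; lra.
(* The least such [n] gives [2 ^- n.+1 < D <= 2 ^- n]: the upper bound makes the grid points
   neighbours, the lower one turns [b ^+ n] into at most [2]^ alpha * D [^ alpha]. *)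
have exn : exists n, (2 ^- n.+1 < D).
  exists (Num.truncn D^-1); rewrite invf_plt ?posrE//.
  apply: (lt_le_trans (truncnS_gt _)).
  by rewrite -natrX ler_nat ltnW// ltn_expl.
have [n hn nmin] := ex_minnP exn.
have Dn : D <= 2 ^- n.
  case: n hn nmin => [|n] hn nmin; first by rewrite expr0 invr1.
  rewrite leNgt; apply/negP => /nmin; by rewrite ltnn.
apply: (le_trans (chaining_bound M0 b0 b1 cf hf' cx cz Dn)).
rewrite -bE -/D [leRHS](_ : _ = M * (1 + 2 / (1 - b)) * (2 `^ alpha * D `^
  alpha)); last by ring.
rewrite ler_wpM2l ?mulr_ge0// -powRM// ?(ltW D0)//.
apply: powR_le_pos; [exact: ltW|by rewrite invr_ge0 exprn_ge0|].
by have := ltW hn; rewrite exprS invfM ler_pdivrMl.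
Qed.

End chaining_hoelder.

(** * From second moments to paths *)

(** The sum of all the [W l i] has expectation at most [K], so it is almost surely finite and bounds
    each of its nonnegative terms. *)
Lemma ae_bounded_of_summable_moments d (T : measurableType d) (R : realType)
    (P : probability T R) (F : nat -> finType) (W : forall l, F l -> T -> R)
    (A : nat -> R) (K : R) :
  (forall l i, measurable_fun [set: T] (W l i)) ->
  (forall l i w, 0 <= W l i w) -> 0 <= K ->
  (forall l i, (\int[P]_w (W l i w)%:E <= (A l)%:E)%E) ->
  (forall l, #|F l|%:R * A l <= K / (2 ^ l.+1)%:R) ->
  {ae P, forall w, exists M : R, forall l i, W l i w <= M}.
Proof.
move=> mW W0 K0 hA hF.
pose S l w : \bar R := (\sum_(i <- enum (F l)) (W l i w)%:E)%E.
have mS l : measurable_fun [set: T] (S l).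
  by apply: emeasurable_sum => i; exact/measurable_EFinP.
have S0 l w : (0 <= S l w)%E by apply: sume_ge0 => i _; rewrite lee_fin.
have intS : (\int[P]_w (\sum_(l <oo) S l w) <= K%:E)%E.
  rewrite integral_nneseries//.
  apply: le_trans (epsilon_trick0 xpredT K0); apply: lee_nneseries => l _.
    by move=> _; exact: integral_ge0.
  rewrite ge0_integral_sum//; last first.
  - by move=> i w _; rewrite lee_fin.
  - by move=> i; exact/measurable_EFinP.
  apply: (@le_trans _ _ (\sum_(i <- enum (F l)) (A l)%:E)%E); first exact:
    lee_sum.
  rewrite sumEFin lee_fin big_const_seq count_predT -cardE iter_addr_0
    -[leLHS]mulr_natl.
  exact: hF.
have mSS : measurable_fun [set: T] (fun w => \sum_(l <oo) S l w)%E.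
  exact: ge0_emeasurable_sum.
have iS : P.-integrable [set: T] (fun w => \sum_(l <oo) S l w)%E.
  apply/integrableP; split => //.
  under eq_integral do (rewrite gee0_abs; last exact: nneseries_ge0).
  exact: le_lt_trans intS (ltry _).
apply: filterS (integrable_ae measurableT iS) => w /(_ I) fw.
exists (fine (\sum_(l <oo) S l w)%E) => l i.
rewrite -lee_fin fineK//.
apply: (@le_trans _ _ (S l w)).
  rewrite /S (bigD1_seq i) ?enum_uniq ?mem_enum//=.
  by rewrite leeDl// sume_ge0// => k _; rewrite lee_fin.
apply: (@le_trans _ _ (\sum_(0 <= k < l.+1) S k w)%E).
  by rewrite big_nat_recr//= leeDr// sume_ge0.
exact: nneseries_lim_ge.
Qed.

Lemma within_continuous_dist (R : realType) (N : nat) (A : set 'rV[R]_N)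
    (f : 'rV[R]_N -> R) (x : 'rV[R]_N) (e : R) :
  {within A, continuous f} -> A x -> 0 < e ->
  exists2 delta : R, 0 < delta &
    forall z, A z -> `|x - z| < delta -> `|f x - f z| < e.
Proof.
move=> /subspace_continuousP cf Ax e0.
have /cvgrPdist_lt/(_ _ e0) := cf x Ax.
rewrite near_withinE => /nbhs_ballP[delta /= d0 h].
exists delta => // z Az xz; apply: h => //.
by rewrite -ball_normE.
Qed.

(** * Neighbourhoods of a point of the orthant as images of the unit cube *)

Section orthant_parametrization.
Context {R : realType} {N : nat}.
Variable t0 : 'rV[R]_N.
Hypothesis ot0 : orthant R N t0.
Implicit Types (x z t u : 'rV[R]_N) (r : R).

(* Maps the unit cube onto a neighbourhood of [t0] in the orthant; the
   coordinates leaving the orthant are projected back. *)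
Definition orthant_param r x : 'rV[R]_N :=
  \row_i Num.max 0 (t0 ord0 i + r * (2 * x ord0 i - 1)).

(** Inverts the affine map inside [orthant_param]; for [t] in the orthant the projection changes
    nothing. *)
Definition orthant_coord r t : 'rV[R]_N :=
  \row_i ((t ord0 i - t0 ord0 i + r) / (2 * r)).

Lemma orthant_param_in r x : orthant R N (orthant_param r x).
Proof. by move=> i; rewrite mxE le_max lexx. Qed.

Lemma max0_lipschitz (a b : R) : `|Num.max 0 a - Num.max 0 b| <= `|a - b|.
Proof.
wlog ab : a b / a <= b => [th|].
  have [/th//|/ltW/th] := leP a b.
  by rewrite distrC (distrC b).
rewrite !(distrC _ b) (distrC _ (Num.max 0 b)) [leRHS]ger0_norm ?subr_ge0//.
rewrite ger0_norm ?subr_ge0; last by rewrite ge_max !le_max lexx ab orbT.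
by case: (leP 0 a) => a0; case: (leP 0 b) => b0; lra.
Qed.

Lemma orthant_param_lipschitz r x z : 0 <= r ->
  `|orthant_param r x - orthant_param r z| <= 2 * r * `|x - z|.
Proof.
move=> r0; apply: norm_rv_le => [|i]; first by rewrite !mulr_ge0.
rewrite !mxE; apply: (le_trans (max0_lipschitz _ _)).
rewrite [X in `|X|](_ : _ = 2 * r * (x ord0 i - z ord0 i)); last by ring.
rewrite normrM ger0_norm ?mulr_ge0// ler_wpM2l ?mulr_ge0//.
by have := coord_le_norm (x - z) i; rewrite !mxE.
Qed.

Lemma orthant_param_dist r x : 0 <= r -> cube x -> `|orthant_param r x - t0| <=
  r.
Proof.
move=> r0 cx; apply: norm_rv_le => // i; rewrite !mxE.
(* The projection fixes [t0], so its Lipschitz property also bounds the distance to [t0]. *)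
have {1}-> : t0 ord0 i = Num.max 0 (t0 ord0 i) by apply/esym/max_idPr; exact:
  ot0.
have {2}-> : t0 ord0 i = Num.max 0 (t0 ord0 i) by apply/esym/max_idPr; exact:
  ot0.
have -> : Num.max 0 (Num.max 0 (t0 ord0 i) + r * (2 * x ord0 i - 1)) =
  Num.max 0 (t0 ord0 i + r * (2 * x ord0 i - 1)).
  by congr (Num.max _ (_ + _)); apply/max_idPr; exact: ot0.
apply: (le_trans (max0_lipschitz _ _)).
rewrite [X in `|X|](_ : _ = r * (2 * x ord0 i - 1)); last by ring.
rewrite normrM ger0_norm// ler_piMr//.
by have /andP[? ?] := cx i; rewrite ler_norml; apply/andP; split; lra.
Qed.

Section coord.
Variables (r : R) (t : 'rV[R]_N).
Hypotheses (r0 : 0 < r) (ot : orthant R N t) (tr : `|t - t0| <= r).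

Lemma orthant_coord_cube : cube (orthant_coord r t).
Proof.
move=> i; rewrite mxE; have := le_trans (coord_le_norm (t - t0) i) tr.
rewrite !mxE ler_norml => /andP[h1 h2].
have r20 : 0 < 2 * r by rewrite mulr_gt0.
rewrite divr_ge0 ?(ltW r20)//=; last by lra.
by rewrite ler_pdivrMr// mul1r; lra.
Qed.

Lemma orthant_coordK : orthant_param r (orthant_coord r t) = t.
Proof.
apply/rowP => i; rewrite !mxE.
rewrite [X in Num.max _ X](_ : _ = t ord0 i); last by field; rewrite gt_eqF.
by apply/max_idPr; exact: ot.
Qed.

End coord.

Lemma orthant_coord_dist r t u : 0 < r ->
  `|orthant_coord r t - orthant_coord r u| <= `|t - u| / (2 * r).
Proof.
move=> r0; have r20 : 0 < 2 * r by rewrite mulr_gt0.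
apply: norm_rv_le => [|i]; first by rewrite divr_ge0// ltW.
rewrite !mxE -mulrBl normrM [X in _ * X]gtr0_norm ?invr_gt0//.
rewrite ler_pM2r ?invr_gt0// [X in `|X|](_ : _ = t ord0 i - u ord0 i); last by
  ring.
by have := coord_le_norm (t - u) i; rewrite !mxE.
Qed.

End orthant_parametrization.

Section grid_facts.
Context {R : realType} {N : nat}.

Lemma grid_cube n (a : 'I_N -> nat) : (forall i, (a i <= 2 ^ n)%N) ->
  cube (grid n a : 'rV[R]_N).
Proof.
move=> ha i; rewrite mxE divr_ge0 ?exprn_ge0//= ler_pdivrMr ?exprn_gt0//.
by rewrite mul1r -natrX ler_nat.
Qed.

Lemma neighbours_dist n (a b : 'I_N -> nat) : neighbours n a b ->
  `|grid n a - grid n b : 'rV[R]_N| <= 2 ^- n.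
Proof.
move=> h; apply: norm_rv_le => [|i]; first by rewrite invr_ge0 exprn_ge0.
rewrite !mxE -mulrBl normrM [X in _ * X]gtr0_norm ?invr_gt0 ?exprn_gt0//.
rewrite ler_piMl ?invr_ge0 ?exprn_ge0//.
have [_ _] := h i; rewrite -!(ler_nat R) -!natr1 => h1 h2.
by rewrite ler_norml; apply/andP; split; lra.
Qed.

End grid_facts.

(** * Passing between balls around [t0] and rescaled unit cubes *)

Section scales.
Context {R : realType} {N : nat} {nrm : 'rV[R]_N -> R}.
Hypothesis N0 : (0 < N)%N.
Hypothesis hnrm : is_norm nrm.
Variable t0 : 'rV[R]_N.
Hypothesis ot0 : orthant R N t0.
Local Notation admissible := (@admissible R N nrm t0).
Local Notation param := (orthant_param t0).

Lemma admissible_scaled (g : 'rV[R]_N -> 'rV[R]_N -> R) s' sigma : 0 < sigma ->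
  (forall t, g t t = 0) -> admissible g s' sigma ->
  exists r0 C : R, [/\ 0 < r0, 0 <= C & forall r x z, 0 < r -> r <= r0 ->
    cube x -> cube z ->
    g (param r x) (param r z) <= C * (`|x - z| `^ sigma * r `^ (sigma - s'))].
Proof.
move=> sg0 gt [delta [C [d0 C0 h]]].
have [c c0 hc] := nrm_le_norm hnrm.
have c20 : 0 < 2 * c by rewrite mulr_gt0.
(* The cube of radius [r] is sent into the open ball of radius [2 * c * r], which this choice keeps
   below [delta]. *)
exists (delta / (4 * c)), (C * ((2 * c) `^ sigma * (2 * c) `^ (- s'))); split.
- by rewrite divr_gt0// mulr_gt0.
- by rewrite !mulr_ge0 ?powR_ge0.
move=> r x z r0 rd cx cz.
have [->|xz] := eqVneq (param r x) (param r z).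
  by rewrite gt !mulr_ge0 ?powR_ge0.
have B y : cube y -> oball nrm t0 (2 * c * r) (param r y).
  move=> cy; split; first exact: orthant_param_in.
  apply: (le_lt_trans (hc _)).
  apply: (@le_lt_trans _ _ (c * r)).
    by rewrite ler_wpM2l ?(ltW c0)// orthant_param_dist// ltW.
  by rewrite -mulrA ltr_pMl ?mulr_gt0// ltr1n.
have rho0 : 0 < 2 * c * r by rewrite mulr_gt0.
have rhod : 2 * c * r < delta.
  move: rd; rewrite ler_pdivlMr ?mulr_gt0// => rd.
  have cr : 0 < c * r by rewrite mulr_gt0.
  rewrite -mulrA; apply: (@lt_le_trans _ _ (r * (4 * c))) => //.
  by rewrite (_ : r * (4 * c) = 4 * (c * r)) ?ltr_pM2r ?ltr_nat//; ring.
apply: (le_trans (h _ _ _ rho0 rhod (B x cx) (B z cz) xz)).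
rewrite -[leRHS]mulrA ler_wpM2l// powRM ?(ltW c20) ?(ltW r0)//.
have -> : r `^ (sigma - s') = r `^ sigma * r `^ (- s').
  by rewrite powRD// (gt_eqF r0) implybT.
rewrite [leRHS](_ : _ = ((2 * c) `^ sigma * r `^ sigma * `|x - z| `^ sigma) *
  ((2 * c) `^ (- s') * r `^ (- s'))); last by ring.
rewrite -!powRM ?mulr_ge0 ?(ltW c0) ?(ltW r0)//.
rewrite ler_wpM2r ?powR_ge0//.
apply: powR_le_pos; [exact: ltW|exact: nrm_ge0|].
apply: (le_trans (hc _)); rewrite -!mulrA mulrCA ler_wpM2l ?(ltW c0)// mulrA.
by apply: orthant_param_lipschitz; exact: ltW.
Qed.

Lemma admissible_of_scaled (f : 'rV[R]_N -> R) (s' tau r0 M : R) :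
  s' < 0 -> 0 < tau -> 0 < r0 -> 0 <= M ->
  {within orthant R N, continuous f} ->
  (forall j n (a b : 'I_N -> nat), neighbours n a b ->
    `|f (param (r0 * 2 ^- j) (grid n a)) - f (param (r0 * 2 ^- j) (grid n b))|
    <= M * ((2 ^- n) `^ tau * (r0 * 2 ^- j) `^ (tau - s'))) ->
  admissible (fun t u => `|f t - f u|) s' tau.
Proof.
move=> s0 tau0 r00 M0 cf hf.
have [c c0 hc] := norm_le_nrm hnrm N0.
have [K K0 hK] := chaining_hoelder (N := N) tau0.
pose C := K * M * (2^-1 `^ tau * ((2 * c) `^ (- s') * c `^ tau)).
exists (r0 / c), C; split; first by rewrite divr_gt0.
  by rewrite !mulr_ge0 ?powR_ge0.
move=> rho t u rho0 rhod Bt Bu tu.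
have crho0 : 0 < c * rho by rewrite mulr_gt0.
have crho : c * rho < r0 by rewrite mulrC -ltr_pdivlMr.
(* Minimality of [j] yields [c * rho <= r <= 2 * (c * rho)] for [r = r0 * 2 ^- j]. *)
have exj : exists j, r0 * 2 ^- j.+1 < c * rho.
  exists (Num.truncn (r0 / (c * rho))).
  rewrite ltr_pdivrMr ?exprn_gt0// mulrC -ltr_pdivrMr//.
  apply: (lt_le_trans (truncnS_gt _)).
  by rewrite -natrX ler_nat ltnW// ltn_expl.
have [j hj jmin] := ex_minnP exj.
have jle : c * rho <= r0 * 2 ^- j.
  case: j hj jmin => [|j] hj jmin; first by rewrite expr0 invr1 mulr1 ltW.
  by rewrite leNgt; apply/negP => /jmin; rewrite ltnn.
have [r rE] : exists r, r = r0 * 2 ^- j by exists (r0 * 2 ^- j).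
have r_gt0 : 0 < r by rewrite rE divr_gt0// exprn_gt0.
have r2 : r <= 2 * (c * rho).
  by have := ltW hj; rewrite rE exprS invfM mulrCA ler_pdivrMl.
have dist y : oball nrm t0 rho y -> `|y - t0| <= r.
  move=> [_ yr]; apply: (le_trans (hc _)); rewrite rE; apply: le_trans jle.
  by rewrite ler_wpM2l ?(ltW c0)// ltW.
pose x := orthant_coord t0 r t; pose z := orthant_coord t0 r u.
have cx : cube x by apply: orthant_coord_cube => //; exact: dist.
have cz : cube z by apply: orthant_coord_cube => //; exact: dist.
have tx : param r x = t by apply: orthant_coordK => //; exact: Bt.1.
have uz : param r z = u by apply: orthant_coordK => //; exact: Bu.1.
have := @hK (fun y => f (param r y)) (M * r `^ (tau - s')).
rewrite mulr_ge0 ?powR_ge0// => /(_ isT) h.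
have {h} : `|f (param r x) - f (param r z)| <=
    K * (M * r `^ (tau - s')) * `|x - z| `^ tau.
  apply: h => //.
    move=> y cy e e0.
    have [del del0 hd] := within_continuous_dist cf (orthant_param_in t0 r y)
      e0.
    exists (del / (2 * r)); first by rewrite divr_gt0// mulr_gt0.
    move=> y' yy'; apply: hd; first exact: orthant_param_in.
    apply: (le_lt_trans (orthant_param_lipschitz t0 _ _ (ltW r_gt0))).
    by rewrite mulrC -ltr_pdivlMr// mulr_gt0.
  by move=> n p q npq; rewrite -mulrA [X in _ * X]mulrC rE; exact: hf.
rewrite tx uz => /le_trans; apply.
have xz : `|x - z| <= c * nrm (t - u) / (2 * r).
  apply: (le_trans (orthant_coord_dist t0 _ _ r_gt0)).
  by rewrite ler_wpM2r// invr_ge0 mulr_ge0// ltW.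
have n0 := nrm_ge0 hnrm (t - u).
apply: (@le_trans _ _ (K * (M * r `^ (tau - s')) * (c * nrm (t - u) / (2 * r))
  `^ tau)).
  rewrite ler_wpM2l ?mulr_ge0 ?powR_ge0//.
  by apply: powR_le_pos => //; exact: ltW.
have ri0 : 0 <= r^-1 by rewrite invr_ge0 ltW.
rewrite invfM (mulrC 2^-1) mulrA powRM ?invr_ge0// ?mulr_ge0 ?(ltW c0)//.
rewrite powRM ?mulr_ge0 ?(ltW c0)// powRM ?(ltW c0)//.
have -> : r `^ (tau - s') = r `^ tau * r `^ (- s').
  by rewrite powRD// (gt_eqF r_gt0) implybT.
have rr : r `^ tau * r^-1 `^ tau = 1.
  by rewrite -powRM ?(ltW r_gt0)// divff ?powR1// gt_eqF.
rewrite [leLHS](_ : _ = K * M * (2^-1 `^ tau * c `^ tau * nrm (t - u) `^ tau) *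
  r `^ (- s') * (r `^ tau * r^-1 `^ tau)); last by ring.
rewrite rr mulr1 /C.
rewrite [leRHS](_ : _ = K * M * (2^-1 `^ tau * c `^ tau * nrm (t - u) `^ tau) *
  ((2 * c) `^ (- s') * rho `^ (- s'))); last by ring.
rewrite ler_wpM2l ?mulr_ge0 ?powR_ge0// -powRM ?mulr_ge0 ?(ltW c0) ?(ltW
  rho0)//.
apply: powR_le_pos; rewrite ?oppr_ge0 ?(ltW s0) ?(ltW r_gt0)//.
by rewrite -mulrA.
Qed.

End scales.

Lemma exprn_lt_eps (R : realType) (th e : R) : 0 <= th -> th < 1 -> 0 < e ->
  exists k, th ^+ k.+1 <= e.
Proof.
move=> th0 th1 e0.
have /cvgrPdist_le/(_ _ e0)[k _ hk] : (GRing.exp th : R ^nat) @ \oo --> (0 : R).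
  by apply: cvg_expr; rewrite ger0_norm.
exists k; have := hk k.+1 (leqnSn k).
by rewrite sub0r normrN ger0_norm// exprn_ge0.
Qed.

(** Beyond 1 the absolute value is below its own powers, so no root of [M] has to be taken. *)
Lemma norm_le_of_exprn_le (R : realType) (y M : R) k :
  y ^+ (2 * k.+1) <= M -> `|y| <= Num.max 1 M.
Proof.
move=> h; have [y1|y1] := leP `|y| 1; first by rewrite le_max y1.
rewrite le_max; apply/orP; right; apply: le_trans h.
rewrite exprM -real_normK ?num_real// -exprM.
by rewrite -[leLHS]expr1; apply: ler_weXn2l => //; exact: ltW.
Qed.

(** Bound [l + 1] by [2 ^ l] and [2 ^ l + 1] by [2 * 2 ^ l]. The growth rate [2 * 4 ^+ N] is what
    the moments must beat. *)
Lemma card_grid_le (R : realType) (N l : nat) :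
  #|{: 'I_l.+1 * ({ffun 'I_N -> 'I_(2 ^ l).+1} * {ffun 'I_N -> 'I_(2 ^
    l).+1})}|%:R
  <= 4 ^+ N * (2 * 4 ^+ N) ^+ l :> R.
Proof.
rewrite !card_prod !card_ffun !card_ord.
have -> : 4 ^+ N * (2 * 4 ^+ N) ^+ l = (2 ^ l * ((2 * 2 ^ l) ^ N * (2 * 2 ^ l)
  ^ N))%:R :> R.
  rewrite !natrM !natrX !natrM !natrX -exprMn.
  rewrite (_ : 2 * 2 ^+ l * (2 * 2 ^+ l) = 4 * 4 ^+ l :> R); last first.
    by rewrite mulrACA -exprMn -natrM.
  by rewrite !exprMn -!exprM (mulnC l N); ring.
have h : ((2 ^ l).+1 <= 2 * 2 ^ l)%N.
  by rewrite mul2n -addnn -addn1 leq_add2l expn_gt0.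
rewrite ler_nat; apply: leq_mul; first exact: ltn_expl.
by apply: leq_mul; case: N => // N'; rewrite leq_exp2r.
Qed.

(** * Kolmogorov's argument over all scales and grid levels *)

Section kolmogorov.
Context {R : realType} {N : nat} {nrm : 'rV[R]_N -> R}.
Hypothesis N0 : (0 < N)%N.
Hypothesis hnrm : is_norm nrm.
Context d (T : measurableType d) (P : probability T R).
Variable X : 'rV[R]_N -> T -> R.
Hypothesis hgauss : gaussian_process P X.
Hypothesis hcont : continuous_process P X.
Variable t0 : 'rV[R]_N.
Hypothesis ot0 : orthant R N t0.
Local Notation admissible := (@admissible R N nrm t0).
Local Notation param := (orthant_param t0).
Local Notation g := (L2_increment P X).

Lemma normalized_moment (k : nat) : exists2 C : R, 0 <= C & forall t u (D B :
  R),
  orthant R N t -> orthant R N u -> 0 < D -> g t u <= B * D -> 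
  (\int[P]_w (((X t w - X u w) / D) ^+ (2 * k))%:E <= (C * B ^+ (2 * k))%:E)%E.
Proof.
have [C C0 hC] := gaussian_moment_le P k.
exists C => // t u D B ot ou D0 hB.
have gY := gaussian_increment hgauss ot ou; have [mY _] := gY.
under eq_integral do rewrite expr_div_n mulrC EFinM.
have D2 : 0 < D ^+ (2 * k) by rewrite exprn_gt0.
rewrite ge0_integralZl//.
- apply: (@le_trans _ _ ((D ^+ (2 * k))^-1%:E * (C * (B * D) ^+ (2 * k))%:E)%E).
    apply: lee_wpmul2l; first by rewrite lee_fin invr_ge0 ltW.
    apply: (le_trans (hC _ gY)); rewrite lee_fin ler_wpM2l//.
    rewrite -L2_increment_sqr -exprM lerXn2r ?nnegrE ?L2_increment_ge0//.
    exact: le_trans (L2_increment_ge0 P X t u) hB.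
  rewrite -EFinM lee_fin exprMn mulrCA ler_wpM2l// mulrCA.
  by rewrite mulVf ?mulr1// gt_eqF.
- by apply/measurable_EFinP; apply: measurable_funX.
- by move=> w _; rewrite lee_fin exprM exprn_ge0// sqr_ge0.
- by rewrite lee_fin invr_ge0 ltW.
Qed.

(** The spare exponent [eps = sigma - tau] makes normalised increments decay like [th ^+ (j + n)] in
    the scale [j] and the level [n]. A high enough moment outweighs the number of pairs of
    neighbours. *)
Lemma admissible_L2_path s' sigma tau : s' < 0 -> 0 < tau -> tau < sigma ->
  admissible g s' sigma ->
  {ae P, forall w, admissible (fun t u => `|X t w - X u w|) s' tau}.
Proof.
move=> s0 tau0 ts gs.
have sg0 := lt_trans tau0 ts.
have [r0 [C1 [r00 C10 hg]]] :=
  admissible_scaled hnrm ot0 sg0 (L2_increment_refl P X) gs.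
have [eps epsE] : exists eps, eps = sigma - tau by exists (sigma - tau).
have eps0 : 0 < eps by rewrite epsE subr_gt0.
pose th : R := 2^-1 `^ eps.
have th0 : 0 <= th by exact: powR_ge0.
have th1 : th < 1.
  have e1 : 1 `^ eps = 1 :> R by rewrite powR1.
  by rewrite -e1; apply: gt0_ltr_powR; rewrite ?nnegrE ?invr_ge0// invf_lt1//
    ltr1n.
have thE n : (2 ^- n) `^ eps = th ^+ n.
  by rewrite -powR_mulrn// /th -powRrM mulrC powRrM powR_mulrn ?invr_ge0//
    exprVn.
(* Half the inverse of the growth rate in [card_grid_le], so the total moment at [j + n = l] is of
   order [2 ^- l]. *)
pose q : R := (4 * 4 ^+ N)^-1.
have q0 : 0 < q by rewrite invr_gt0 mulr_gt0 ?exprn_gt0.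
have [k hk] := exprn_lt_eps th0 th1 q0.
have [Cm Cm0 hm] := normalized_moment k.+1.
have [r rE] : exists r : nat -> R, forall j, r j = r0 * 2 ^- j.
  by exists (fun j => r0 * 2 ^- j).
have r_gt0 j : 0 < r j by rewrite rE divr_gt0 ?exprn_gt0.
have r_le j : r j <= r0.
  by rewrite rE ler_piMr ?(ltW r00)// invf_le1 ?exprn_gt0// exprn_ege1// ler1n.
have [D DE] : exists D : nat -> nat -> R,
    forall j n, D j n = (2 ^- n) `^ tau * r j `^ (tau - s').
  by exists (fun j n => (2 ^- n) `^ tau * r j `^ (tau - s')).
have D0 j n : 0 < D j n by rewrite DE mulr_gt0 ?powR_gt0 ?invr_gt0 ?exprn_gt0.
pose V j n (a b : 'I_N -> nat) w :=
  X (param (r j) (grid n a)) w - X (param (r j) (grid n b)) w.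
pose K0 := Cm * (C1 * r0 `^ eps) ^+ (2 * k.+1).
have K00 : 0 <= K0 by rewrite mulr_ge0// exprn_ge0// mulr_ge0// powR_ge0.
have key j n a b : neighbours n a b ->
    (\int[P]_w ((V j n a b w / D j n) ^+ (2 * k.+1))%:E <= (K0 * q ^+ (j +
      n))%:E)%E.
  move=> nab.
  have ca : cube (grid n a : 'rV[R]_N) by apply: grid_cube => i; have [] := nab
    i.
  have cb : cube (grid n b : 'rV[R]_N) by apply: grid_cube => i; have [] := nab
    i.
  have hB : g (param (r j) (grid n a)) (param (r j) (grid n b)) <=
      C1 * r0 `^ eps * th ^+ (j + n) * D j n.
    apply: (le_trans (hg _ _ _ (r_gt0 j) (r_le j) ca cb)).
    apply: (@le_trans _ _ (C1 * ((2 ^- n) `^ sigma * r j `^ (sigma - s')))).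
      rewrite ler_wpM2l// ler_wpM2r ?powR_ge0//.
      by apply: powR_le_pos; [exact: ltW| |exact: neighbours_dist].
    have -> : sigma = eps + tau by rewrite epsE subrK.
    have n0 : 2 ^- n != 0 :> R by rewrite invr_neq0// expf_neq0.
    rewrite -addrA DE [(2 ^- n) `^ (_ + _)]powRD ?n0 ?implybT//.
    rewrite [r j `^ (eps + _)]powRD ?(gt_eqF (r_gt0 _)) ?implybT//.
    rewrite thE [in r j `^ eps]rE powRM ?(ltW r00) ?invr_ge0 ?exprn_ge0// thE
      exprD.
    by rewrite le_eqVlt; apply/orP; left; apply/eqP; ring.
  have := hm _ _ _ _ (orthant_param_in t0 _ _) (orthant_param_in t0 _ _) (D0 j
    n) hB.
  move=> /le_trans; apply.
  rewrite lee_fin /K0 exprMn -mulrA ler_wpM2l// ler_wpM2l ?exprn_ge0 ?mulr_ge0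
    ?powR_ge0//.
  rewrite -exprM mulnC -mulnA mulnC !exprM.
  have t1 : th ^+ k.+1 <= 1 by rewrite exprn_ile1// ltW.
  have t2 : 0 <= th ^+ k.+1 by rewrite exprn_ge0.
  apply: (@le_trans _ _ ((th ^+ k.+1) ^+ (j + n))).
    by rewrite expr2 ler_piMr ?exprn_ge0// exprn_ile1.
  by rewrite lerXn2r ?nnegrE// ltW.
(* [F l] gathers all scales [j <= l] with level [n = l - j]. Indices range up to [2 ^ l] for every
   [j], and [W] is 0 on pairs that are not neighbours. *)
pose F l : finType := ('I_l.+1 * ({ffun 'I_N -> 'I_(2 ^ l).+1} * {ffun 'I_N ->
  'I_(2 ^ l).+1}))%type.
pose nf l (a : {ffun 'I_N -> 'I_(2 ^ l).+1}) : 'I_N -> nat := fun i => a i.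
pose W l (i : F l) w : R := if `[< neighbours (l - i.1) (nf l i.2.1) (nf l
  i.2.2) >] then
  (V i.1 (l - i.1)%N (nf l i.2.1) (nf l i.2.2) w / D i.1 (l - i.1)%N) ^+ (2 *
    k.+1) else 0.
have bnd : {ae P, forall w, exists M : R, forall l i, W l i w <= M}.
  apply: (@ae_bounded_of_summable_moments _ _ _ P F W (fun l => K0 * q ^+ l) (2
    * 4 ^+ N * K0)).
  - move=> l i; rewrite /W; case: asboolP => _ //.
    apply: measurable_funX; apply: measurable_funM => //.
    by have [] := gaussian_increment hgauss (orthant_param_in t0 (r i.1) (grid
      (l - i.1) (nf l i.2.1)))
      (orthant_param_in t0 (r i.1) (grid (l - i.1) (nf l i.2.2))).
  - by move=> l i w; rewrite /W; case: asboolP => _ //; rewrite exprM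
    exprn_ge0// sqr_ge0.
  - by rewrite mulr_ge0// mulr_ge0// exprn_ge0.
  - move=> l i; rewrite /W; case: asboolP => [nab|_].
      have := key i.1 _ _ _ nab; rewrite subnKC//.
      by rewrite -ltnS; exact: ltn_ord.
    by rewrite integral0 lee_fin mulr_ge0// exprn_ge0// ltW.
  - move=> l; apply: (le_trans (ler_wpM2r _ (card_grid_le R N l))).
      by rewrite mulr_ge0// exprn_ge0// ltW.
    rewrite natrX exprS invfM.
    rewrite [leLHS](_ : _ = 4 ^+ N * K0 * ((2 * 4 ^+ N) * q) ^+ l); last first.
      by rewrite (exprMn l (2 * _) q); ring.
    have -> : 2 * 4 ^+ N * q = 2^-1 :> R.
      by rewrite /q; field; rewrite expf_neq0.
    rewrite exprVn le_eqVlt; apply/orP; left; apply/eqP; field.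
    by rewrite expf_neq0.
apply: filterS2 bnd hcont => w [M hM] cw.
apply: (@admissible_of_scaled _ _ _ N0 hnrm t0 (fun t => X t w) s' tau r0
  (Num.max 1 M)) => //.
  by rewrite le_max ler01.
move=> j n a b nab; rewrite -rE -DE -ler_pdivrMr//.
rewrite -[X in _ / X](gtr0_norm (D0 j n)) -normf_div.
apply: (@norm_le_of_exprn_le _ _ _ k).
pose l := (j + n)%N.
have lt_j : (j < l.+1)%N by rewrite ltnS leq_addr.
have pw : (2 ^ n <= 2 ^ l)%N by rewrite leq_exp2l// leq_addl.
(* [inord] is faithful here, since the indices are at most [2 ^ n <= 2 ^ l]. *)
pose fa (c : 'I_N -> nat) : {ffun 'I_N -> 'I_(2 ^ l).+1} := [ffun i => inord (c
  i)].
have faE c : (forall i, (c i <= 2 ^ n)%N) -> nf l (fa c) = c.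
  by move=> hc; apply/funext => i; rewrite /nf ffunE inordK// ltnS (leq_trans
    (hc i)).
have ea : nf l (fa a) = a by apply: faE => i; have [] := nab i.
have eb : nf l (fa b) = b by apply: faE => i; have [] := nab i.
have := hM l (Ordinal lt_j, (fa a, fa b)); rewrite /W /= ea eb.
have -> : (l - j)%N = n by rewrite /l addKn.
by case: asboolP.
Qed.

End kolmogorov.

(** * The two frontiers *)

Lemma ae_forall_countable d (T : measurableType d) (R : realType)
    (P : probability T R) (I : countType) (Q : I -> T -> Prop) :
  (forall i, {ae P, forall w, Q i w}) -> {ae P, forall w, forall i, Q i w}.
Proof.
move=> h.
pose B n := [set w | exists2 i, pickle i = n & ~ Q i w].
apply: (@negligibleS _ _ _ _ (\bigcup_n B n)).
  by move=> w /= /existsNP[i hi]; exists (pickle i) => //; exists i.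
apply: negligible_bigcup => n.
have [[i iE]|ni] := pselect (exists i : I, pickle i = n).
  apply: negligibleS (h i) => w /= [j jE]; rewrite (_ : j = i)//.
  by apply: (pcan_inj pickleK); rewrite jE.
apply: negligibleS (negligible_set0 P) => w /= [j jE _].
by apply: ni; exists j.
Qed.

Unset Implicit Arguments.

Theorem theorem3p11 (R : realType) (N : nat) (hN : (0 < N)%N)
    (nrm : 'rV[R]_N -> R) (hnrm : is_norm nrm)
    (d : measure_display) (T : measurableType d) (P : probability T R)
    (X : 'rV[R]_N -> T -> R)
    (hgauss : gaussian_process P X) (hcont : continuous_process P X)
    (t0 : 'rV[R]_N) (ht0 : orthant R N t0)
    (hD : {ae P, forall w,
             graph_meets (frontier nrm (fun t => X t w) t0) (@regionD R)}) :
  {ae P, forall w, forall s' : R, s' < 0 ->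
     frontier nrm (fun t => X t w) t0 s' = det_frontier P nrm X t0 s'}.
Proof.
pose f w := fun t u : 'rV[R]_N => `|X t w - X u w|.
pose g := L2_increment P X.
have E1 : {ae P, forall w, forall qr : rat * rat,
    @admissible _ _ nrm t0 (f w) (ratr qr.1) (ratr qr.2) ->
    @admissible _ _ nrm t0 g (ratr qr.1) (ratr qr.2)}.
  by apply: ae_forall_countable => qr; exact: admissible_path_L2.
have E2 : {ae P, forall w, forall qrp : rat * rat * rat,
    ratr qrp.1.1 < 0 :> R -> 0 < ratr qrp.2 :> R ->
    ratr qrp.2 < ratr qrp.1.2 :> R ->
    @admissible _ _ nrm t0 g (ratr qrp.1.1) (ratr qrp.1.2) ->
    @admissible _ _ nrm t0 (f w) (ratr qrp.1.1) (ratr qrp.2)}.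
  apply: ae_forall_countable => -[[q r] p] /=.
  (* The premises do not depend on [w], so they are decided first; if one fails the implication is
     vacuous. *)
  have [q0|q0] := ltP (ratr q : R) 0; last by apply: aeW.
  have [p0|p0] := ltP 0 (ratr p : R); last by apply: aeW.
  have [pr|pr] := ltP (ratr p : R) (ratr r); last by apply: aeW.
  have [gqr|gqr] := pselect (@admissible _ _ nrm t0 g (ratr q) (ratr r)).
    have := admissible_L2_path hN hnrm hgauss hcont ht0 q0 p0 pr gqr.
    by apply: filterS => w.
  by apply: aeW.
apply: filterS3 E1 E2 hD => w e1 e2 [s0 [sigma0 [s00 fs0 [_ _ /= sg00 _]]]] s'
  s'0.
have {}e1 : forall s' sigma e, @admissible _ _ nrm t0 (f w) s' sigma -> 0 < e ->
    @admissible _ _ nrm t0 g s' (sigma - e).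
  by apply: (admissible_transfer hnrm) => q r; exact: (e1 (q, r)).
have {}e2 := admissible_transfer_pos hnrm (fun q r p => e2 (q, r, p)).
rewrite (frontierE hnrm) in fs0.
(* A positive frontier value provides a path-admissible [sigma1 > 0] at [s0]; losing half of it
   leaves a positive L^2-admissible exponent, the starting point for interpolation. *)
have : (0 < adm_sup (nrm := nrm) t0 (f w) s0)%E by rewrite fs0 lte_fin.
move=> /ereal_sup_gt[_ [sigma1 /= fs1 <-]].
rewrite lte_fin => sg1.
have gs1 : @admissible _ _ nrm t0 g s0 (sigma1 - sigma1 / 2).
  by apply: e1 => //; rewrite divr_gt0.
have sg1' : 0 < sigma1 - sigma1 / 2 by lra.
rewrite (frontierE hnrm) (det_frontierE hnrm t0 (P := P) (X := X) s'
  (L2_increment_ge0 P X)); last first.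
  exact: L2_increment_expectation.
apply/eqP; rewrite eq_le; apply/andP; split; apply: adm_sup_le => sigma e.
  exact: e1.
exact: (admissible_transfer_neg hnrm ht0 (ler0n _ 2) (L2_increment_ge0 P X)
  (L2_increment_refl P X t0)
  (fun t u => L2_increment_quasi_triangle hgauss ht0) e2 s00 sg1' gs1 s'0).
Qed.
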